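(* Unless P $=$ NP, there is no incremental-polynomial time algorithm for Internal Steiner Tree Enumeration.
   Context: For an undirected graph $G=(V,E)$ and $W\subseteq V$, a Steiner tree of $(G,W)$ is a subtree of $G$ containing a path between every pair of vertices of $W$. An internal Steiner tree of $(G,W)$ is a Steiner tree of $(G,W)$ in which every vertex of $W$ is an internal (non-leaf) vertex. Internal Steiner Tree Enumeration: given $G$ and $W$, output, each exactly once, all minimal internal Steiner trees of $(G,W)$ (internal Steiner trees no proper subgraph of which is an internal Steiner tree of $(G,W)$). An enumeration algorithm runs in incremental-polynomial time if, for every $i$, the time between the $(i-1)$-st and the $i$-th output (and until termination after the last output) is bounded by a polynomial in the input size plus $i$. *)

(* Defs.v *)
From HB Require Import structures.
From mathcomp Require Import all_boot all_order all_algebra.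
Set Implicit Arguments.
Unset Strict Implicit.
Unset Printing Implicit Defensive.

(** * Multitape Turing machines *)

(* [None] is the blank, [Some (inl b)] a bit, and [Some (inr a)] an auxiliary
   symbol of the machine. *)
Definition symbol (A : finType) : Type := option (bool + A).

Variant move := MoveLeft | Stay | MoveRight.

(* A two-way infinite tape, blank almost everywhere: the cells to the left of
   the head (nearest first), and the cells from the head rightwards. *)
Definition tape (A : finType) : Type := (seq (symbol A) * seq (symbol A))%type.

Section Tape.
Variable A : finType.
Implicit Types (t : tape A) (x : seq bool).

Definition read t : symbol A := head None t.2.

Definition write (s : symbol A) t : tape A := (t.1, s :: behead t.2).

Definition shift (m : move) t : tape A :=
  match m with
  | MoveLeft => (behead t.1, head None t.1 :: t.2)
  | Stay => t
  | MoveRight => (head None t.2 :: t.1, behead t.2)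
  end.

Definition blank_tape : tape A := ([::], [::]).
Definition tape_of_word x : tape A := ([::], [seq Some (inl b) | b <- x]).

Fixpoint leading_bits (s : seq (symbol A)) : seq bool :=
  if s is Some (inl b) :: s' then b :: leading_bits s' else [::].

(* The word that starts under the head and ends before the first non-bit. *)
Definition word_of_tape t : seq bool := leading_bits t.2.
End Tape.

(* [trans q r] lists the moves allowed in state [q] when [r] is read; the
   machine halts when there is none. Tape [ord0] is the input tape. *)
Record tm := TM {
  state : finType;
  aux : finType;
  tapes : nat;
  start : state;
  trans : state -> {ffun 'I_tapes.+1 -> symbol aux} ->
          seq (state * {ffun 'I_tapes.+1 -> symbol aux * move}) }.

Definition config (M : tm) : Type :=
  (state M * {ffun 'I_(tapes M).+1 -> tape (aux M)})%type.

Section Runs.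
Variable M : tm.
Implicit Types (c : config M) (x : seq bool).

Definition init x : config M :=
  (start M, [ffun i => if i == ord0 then tape_of_word (aux M) x
                       else blank_tape (aux M)]).

Definition successors c : seq (config M) :=
  [seq (a.1, [ffun i => shift (a.2 i).2 (write (a.2 i).1 (c.2 i))])
     | a : state M * {ffun 'I_(tapes M).+1 -> symbol (aux M) * move}
         <- trans c.1 [ffun i => read (c.2 i)]].

Definition halted c : bool := nilp (successors c).

Definition computation c (cs : seq (config M)) : bool :=
  path (fun c1 c2 => c2 \in successors c1) c cs.

Definition deterministic : Prop :=
  forall q r, size (@trans M q r) <= 1.

(* When [M] is deterministic, its configuration after [t] steps on input [x];
   it no longer changes once [M] has halted. *)
Definition run x (t : nat) : config M :=
  iter t (fun c => head c (successors c)) (init x).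
End Runs.

(** * P and NP *)

Definition language : Type := seq bool -> Prop.

Record acceptor := Acceptor {
  acceptor_tm :> tm;
  accepting : pred (state acceptor_tm) }.

Definition accepts (M : acceptor) (x : seq bool) : Prop :=
  exists2 cs, computation (init M x) cs &
    let c := last (init M x) cs in halted c && accepting c.1.

Definition decides_in_poly_time (M : acceptor) (L : language) : Prop :=
  (forall x, accepts M x <-> L x) /\
  exists p : {poly nat}, forall x cs,
    computation (init M x) cs -> size cs <= p.[size x]%R.

Definition in_P (L : language) : Prop :=
  exists2 M : acceptor, deterministic M & decides_in_poly_time M L.

Definition in_NP (L : language) : Prop :=
  exists M : acceptor, decides_in_poly_time M L.

Definition P_eq_NP : Prop := forall L : language, in_P L <-> in_NP L.

(** * Enumeration algorithms *)

Record enum_problem := EnumProblem {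
  instance : Type;
  encode : instance -> seq bool;
  solution : instance -> seq bool -> Prop }.

(* A deterministic machine which outputs the word on its output tape at each
   step taken from an emitting state. *)
Record enumerator := Enumerator {
  enum_tm :> tm;
  enum_tmP : deterministic enum_tm;
  emitting : pred (state enum_tm);
  out_tape : 'I_(tapes enum_tm).+1 }.

Section Enumeration.
Variables (M : enumerator) (x : seq bool).

Definition halts_at (T : nat) : Prop :=
  halted (run M x T) /\ forall t, t < T -> ~~ halted (run M x t).

Definition output_times (T : nat) : seq nat :=
  [seq t <- iota 0 T | emitting (run M x t).1].

Definition outputs (T : nat) : seq (seq bool) :=
  [seq word_of_tape ((run M x t).2 (out_tape M)) | t <- output_times T].

(* The starting time, the times of the outputs, and the termination time. *)
Definition event_times (T : nat) : seq nat :=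
  0 :: rcons (output_times T) T.

(* The time that leads to the [i]-th output, counted from 1, or to termination
   if there are exactly [i - 1] outputs. *)
Definition delay (T i : nat) : nat :=
  nth 0 (event_times T) i - nth 0 (event_times T) i.-1.
End Enumeration.

Definition enumerates_in_incremental_poly_time
    (M : enumerator) (Pb : enum_problem) : Prop :=
  exists p : {poly nat}, forall I : instance Pb, let x := encode I in
  exists T : nat,
  [/\ halts_at M x T,
      uniq (outputs M x T),
      forall w, w \in outputs M x T <-> solution I w
    & forall i, 0 < i <= (size (outputs M x T)).+1 ->
        delay M x T i <= p.[(size x + i)%N]%R].

(** * Internal Steiner trees *)

Record graph (V : finType) := Graph {
  vertices : {set V};
  edges : {set {set V}};
  graphP : [forall e in edges, (#|e| == 2) && (e \subset vertices)] }.

Section Graphs.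
Variable V : finType.
Implicit Types (G H T : graph V) (W : {set V}).

Definition adj H : rel V := fun u v => [set u; v] \in edges H.

Definition subgraph H G : bool :=
  (vertices H \subset vertices G) && (edges H \subset edges G).

Definition proper_subgraph H G : bool := subgraph H G && ~~ subgraph G H.

Definition has_path H (u v : V) : bool :=
  [&& u \in vertices H, v \in vertices H & connect (adj H) u v].

Definition connected H : Prop :=
  vertices H != set0 /\
  forall u v, u \in vertices H -> v \in vertices H -> has_path H u v.

(* A [ucycle] of size 2 runs back and forth along one edge. *)
Definition acyclic H : Prop :=
  forall c : seq V, ucycle (adj H) c -> size c <= 2.

Definition tree H : Prop := connected H /\ acyclic H.

Definition degree H (v : V) : nat := #|[set e in edges H | v \in e]|.

Definition leaf H (v : V) : bool := (v \in vertices H) && (degree H v == 1).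

Definition internal H (v : V) : bool := (v \in vertices H) && ~~ leaf H v.

Definition steiner_tree G W T : Prop :=
  [/\ subgraph T G, tree T
    & forall u v, u \in W -> v \in W -> has_path T u v].

Definition internal_steiner_tree G W T : Prop :=
  steiner_tree G W T /\ forall v, v \in W -> internal T v.

Definition minimal_internal_steiner_tree G W T : Prop :=
  internal_steiner_tree G W T /\
  forall T', proper_subgraph T' T -> ~ internal_steiner_tree G W T'.
End Graphs.

Definition set_bits n (S : {set 'I_n}) : seq bool :=
  [seq v \in S | v <- enum 'I_n].

(* The adjacency matrix, row by row. *)
Definition adj_bits n (H : graph 'I_n) : seq bool :=
  [seq adj H u v | u <- enum 'I_n, v <- enum 'I_n].

Record steiner_instance := SteinerInstance {
  num_vertices : nat;
  host : graph 'I_num_vertices;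
  terminals : {set 'I_num_vertices};
  hostP : vertices host = [set: 'I_num_vertices] }.

Definition encode_steiner_instance (I : steiner_instance) : seq bool :=
  nseq (num_vertices I) true ++ false :: adj_bits (host I) ++ set_bits (terminals I).

Definition encode_subgraph n (H : graph 'I_n) : seq bool :=
  set_bits (vertices H) ++ adj_bits H.

Definition internal_steiner_tree_enumeration : enum_problem :=
  {| instance := steiner_instance;
     encode := encode_steiner_instance;
     solution := fun I w =>
       exists2 T, minimal_internal_steiner_tree (host I) (terminals I) T
                & w = encode_subgraph T |}.

(* Main.v *)
From Stdlib Require Import FunctionalExtensionality Classical.
From HB Require Import structures.
From mathcomp Require Import all_boot all_order all_algebra zify.
Require Import Defs.
Set Implicit Arguments.
Unset Strict Implicit.
Unset Printing Implicit Defensive.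

(* An incremental-polynomial enumerator reaches its first output, or halts, in
   polynomial time, hence decides whether an internal Steiner tree exists. It
   remains to reduce every language of NP to this question in polynomial time.

   A computation of a nondeterministic machine within time [r] is a labelling
   of a grid of [C > r + 1] columns, with local constraints between the cells
   [p] and [p + 1], and [p] and [p + C]. In the graph, all terminals below are
   joined to a ground vertex [G] by forced edges, i.e. through a terminal of
   degree two. The terminal [VC] of a cell needs one more edge, which picks a
   label [l] by joining the first copy of [l] to the ground. Each copy is a
   forced path [Nu - Mu - Nn]; its terminal [Nn] needs one more edge, to its own
   grounded terminal [Gg] or to an exit [Pp], and [Gg] needs one more edge, to
   [Nn] or to the next copy. Once a copy is grounded, the edge [Nn - Gg] would
   close a cycle, so that [Nn] uses its exit and [Gg] grounds the next copy.
   Two incompatible labels share an exit, so picking both closes a cycle.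
   Conversely, a labelling yields a tree given by explicit parents.

   As the graph is local, its adjacency matrix is written by nested loops over
   unary counters, where a tape whose head is at the difference of two cell
   numbers shows whether they are related. *)

(** * Polynomial bounds *)

(** Internality asks a terminal for only two edges, so one terminal can be forced through one exit
    and no more. This is why a label has one copy per possible conflict (a side, a direction,
    another label): each copy tests a single conflict. Copies exist for all conflicts, real or not,
    so that all cells carry the same vertices; where nothing conflicts, the copy has an exit of its
    own.

    In the tableau every tape is folded at its head. The head then stays in column 0, where the
    instruction is checked against [trans]; the row carries the instruction along, and the whole
    tape shifts. Since a column depends on the next one, one reliable column is lost per row at the
    right end, whence a width above [r + 1]. For inputs of size [m], unary counters of length
    [m + 2] are nested [k] deep for the height and [k + 1] deep for the width.

    Only the first delay of the enumerator is used, at [i = 1]. It lists minimal trees only, but a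
    minimal one exists as soon as any internal Steiner tree does. *)

Definition poly_bounded (f : nat -> nat) : Prop :=
  exists k, forall m, f m <= (m + 2) ^ k.

Lemma leq_exp_base2 m k : k <= (m + 2) ^ k.
Proof. by apply: ltnW; apply: ltn_expl; rewrite addn2. Qed.

(** Both powers are at least 1, so their sum is at most twice their product, and the base [m + 2]
    absorbs the factor 2. One exponent thus covers constants, sums and products. *)
Lemma exp_base2_add m k l : (m + 2) ^ k + (m + 2) ^ l <= (m + 2) ^ (k + l).+1.
Proof.
have h e : 0 < (m + 2) ^ e by rewrite expn_gt0 addn2.
rewrite expnS expnD; have := h k; have := h l.
move: ((m + 2) ^ k) ((m + 2) ^ l) => a b ha hb; nia.
Qed.

Lemma pb_const c : poly_bounded (fun=> c).
Proof. by exists c => m; apply: leq_exp_base2. Qed.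

Lemma pb_id : poly_bounded id.
Proof. by exists 1 => m; rewrite expn1 leq_addr. Qed.

Lemma pb_add f g : poly_bounded f -> poly_bounded g ->
  poly_bounded (fun m => f m + g m).
Proof.
move=> [k hk] [l hl]; exists (k + l).+1 => m.
exact: leq_trans (leq_add (hk m) (hl m)) (exp_base2_add _ _ _).
Qed.

Lemma pb_mul f g : poly_bounded f -> poly_bounded g ->
  poly_bounded (fun m => f m * g m).
Proof.
by move=> [k hk] [l hl]; exists (k + l) => m; rewrite expnD leq_mul.
Qed.

Lemma pb_exp f k : poly_bounded f -> poly_bounded (fun m => f m ^ k).
Proof.
move=> [l hl]; exists (l * k) => m; rewrite expnM.
by case: k => // k; rewrite leq_exp2r.
Qed.

Lemma pb_le f g : (forall m, f m <= g m) -> poly_bounded g -> poly_bounded f.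
Proof. by move=> h [k hk]; exists k => m; apply: leq_trans (h m) (hk m). Qed.

Lemma pb_poly (p : {poly nat}) : poly_bounded (fun m => p.[m]%R).
Proof.
elim/poly_ind: p => [|p c IH].
  by apply: (pb_le (g := fun=> 0)) (pb_const 0) => m; rewrite horner0.
apply: (pb_le (g := fun m => p.[m]%R * m + c)).
  by move=> m; rewrite hornerMXaddC.
exact: pb_add (pb_mul IH pb_id) (pb_const c).
Qed.

Lemma pb_horner (p : {poly nat}) f :
  poly_bounded f -> poly_bounded (fun m => p.[f m]%R).
Proof.
case: (pb_poly p) => k hk pf.
apply: (pb_le (g := fun m => (f m + 2) ^ k)); first by move=> m; apply: hk.
by apply: pb_exp; apply: pb_add (pb_const 2).
Qed.

Lemma pb_polyP f : poly_bounded f ->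
  exists p : {poly nat}, forall m, f m <= p.[m]%R.
Proof.
case=> k hk; exists (('X + 2%:P) ^+ k)%R => m.
have -> : ((('X + 2%:P) ^+ k : {poly nat}).[m])%R = (m + 2) ^ k; last exact: hk.
rewrite horner_exp hornerD hornerX hornerC.
by elim: k {hk} => // k IH; rewrite GRing.exprS IH expnS.
Qed.

(** * While programs over named tapes *)

Section AbstractTapes.
Variable A : finType.

(* The contents of a two-way infinite tape, and the position of the head. *)
Definition atape : Type := ((int -> symbol A) * int)%type.

Definition aread (t : atape) : symbol A := t.1 t.2.
Definition awrite (s : symbol A) (t : atape) : atape :=
  (fun z => if z == t.2 then s else t.1 z, t.2).
Definition dir (m : Defs.move) : int :=
  match m with MoveLeft => -1 | Stay => 0 | MoveRight => 1 end%R.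
Definition ashift (m : Defs.move) (t : atape) : atape := (t.1, t.2 + dir m)%R.
Definition ablank : atape := (fun=> None, 0%R).
Definition word_at (x : seq bool) (z : int) : symbol A :=
  if z is Posz i then nth None [seq Some (inl b) | b <- x] i else None.

Lemma awrite_same t : ashift Stay (awrite (aread t) t) = t.
Proof.
case: t => f h; rewrite /ashift /awrite /aread /= GRing.addr0; congr pair.
by apply: functional_extensionality => z; case: eqP => [->|].
Qed.

Variable B : finType.
Variable e : symbol B -> symbol A.

(** Positions are relative to the head, and [nth None] ignores trailing blanks. The encoding [e] is
    [id] when programs are compiled, and [put_sym] when a program simulates the enumerator. *)
Definition represents (t : tape B) (a : atape) : Prop :=
  (forall i : nat, e (nth None t.2 i) = a.1 (a.2 + i%:Z)%R) /\
  (forall i : nat, e (nth None t.1 i) = a.1 (a.2 - 1 - i%:Z)%R).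

Lemma represents_read t a : represents t a -> e (read t) = aread a.
Proof. by case=> /(_ 0); rewrite nth0 GRing.addr0. Qed.

Lemma represents_step t a s m : e None = None -> represents t a ->
  represents (shift m (write s t)) (ashift m (awrite (e s) a)).
Proof.
move=> eN [hr hl].
case: a hr hl => f h /= hr hl; case: t hr hl => l r /= hr hl.
case: m; rewrite /represents /ashift /awrite /=; split=> i.
- case: i => [|[|i]] /=.
  + rewrite -nth0 hl; case: eqP => [|_]; first lia.
    by congr f; lia.
  + by rewrite ifT //; apply/eqP; lia.
  + rewrite nth_behead hr; case: eqP => [|_]; first lia.
    by congr f; lia.
- rewrite nth_behead hl; case: eqP => [|_]; first lia.
  by congr f; lia.
- case: i => [|i] /=; first by rewrite ifT //; apply/eqP; lia.
  rewrite nth_behead hr; case: eqP => [|_]; first lia.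
  by congr f; lia.
- rewrite hl; case: eqP => [|_]; first lia.
  by congr f; lia.
- rewrite nth_behead hr; case: eqP => [|_]; first lia.
  by congr f; lia.
- case: i => [|i] /=; first by rewrite ifT //; apply/eqP; lia.
  rewrite hl; case: eqP => [|_]; first lia.
  by congr f; lia.
Qed.
End AbstractTapes.

Section Programs.
Variables A T : finType.

(* Tape [None] is the input tape. *)
Definition memory : Type := option T -> atape A.
Definition readings : Type := option T -> symbol A.
Definition action : Type := option T -> symbol A * Defs.move.

Definition rd (s : memory) : readings := fun t => aread (s t).
Definition upd (a : action) (s : memory) : memory :=
  fun t => ashift (a t).2 (awrite (a t).1 (s t)).
Definition init_memory (x : seq bool) : memory := fun t =>
  if t is None then (word_at A x, 0%R) else ablank A.

Inductive cmd :=
| Act of (readings -> action)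
| Seq of cmd & cmd
| While of (readings -> bool) & cmd.

(** Times are exact: each action and each test of a loop compiles to one machine step. Upper bounds
    come with [execb] below. *)
Inductive exec : cmd -> memory -> nat -> memory -> Prop :=
| exec_act f s : exec (Act f) s 1 (upd (f (rd s)) s)
| exec_seq c d s1 n1 s2 n2 s3 :
    exec c s1 n1 s2 -> exec d s2 n2 s3 -> exec (Seq c d) s1 (n1 + n2) s3
| exec_done b c s : b (rd s) = false ->
    exec (While b c) s 1 (upd (fun t => (rd s t, Stay)) s)
| exec_loop b c s1 n1 s2 n2 s3 : b (rd s1) = true ->
    exec c s1 n1 s2 -> exec (While b c) s2 n2 s3 ->
    exec (While b c) s1 (n1 + n2).+1 s3.

Lemma upd_same s : upd (fun t => (rd s t, Stay)) s = s.
Proof. by apply: functional_extensionality => t; apply: awrite_same. Qed.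

Fixpoint cstate (c : cmd) : finType :=
  match c with
  | Act _ => unit
  | Seq c d => (cstate c + cstate d)%type
  | While _ c => option (cstate c)
  end.

Fixpoint cstart (c : cmd) : cstate c :=
  match c with
  | Act _ => tt
  | Seq c d => inl (cstart c)
  | While _ c => None
  end.

(* The next state is [None] when the command terminates. *)
Fixpoint cstep (c : cmd) : cstate c -> readings -> option (cstate c) * action :=
  match c return cstate c -> readings -> option (cstate c) * action with
  | Act f => fun _ r => (None, f r)
  | Seq c d => fun q r =>
      match q with
      | inl q => let qa := cstep q r in
          (Some (if qa.1 is Some q' then inl q' else inr (cstart d)), qa.2)
      | inr q => let qa := cstep q r in (omap inr qa.1, qa.2)
      end
  | While b c => fun q r =>
      match q with
      | None => (if b r then Some (Some (cstart c)) else None,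
                 fun t => (r t, Stay))
      | Some q => let qa := cstep q r in (Some qa.1, qa.2)
      end
  end.

Inductive runs (c : cmd) : cstate c -> memory -> nat -> memory -> Prop :=
| runs_exit q s : (cstep q (rd s)).1 = None ->
    runs q s 1 (upd (cstep q (rd s)).2 s)
| runs_step q s q' n s' : (cstep q (rd s)).1 = Some q' ->
    runs q' (upd (cstep q (rd s)).2 s) n s' -> runs q s n.+1 s'.

Lemma runs_seq c d (q : cstate c) s1 n1 s2 n2 s3 :
  runs q s1 n1 s2 -> runs (cstart d) s2 n2 s3 ->
  runs (inl q : cstate (Seq c d)) s1 (n1 + n2) s3.
Proof.
move=> r1 r2; elim: r1 r2 => {q s1 n1 s2} [q s h|q s q' n s' h _ IH] r2.
  by apply: (@runs_step (Seq c d) (inl q) s (inr (cstart d))); rewrite /= ?h //;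
    elim: r2 => {s h q} [q s h|q s q' n s' h _ IH];
    [apply: (@runs_exit (Seq c d) (inr q)); rewrite /= h
    |apply: (@runs_step (Seq c d) (inr q) s (inr q')); rewrite /= ?h].
apply: (@runs_step (Seq c d) (inl q) s (inl q')); rewrite /= ?h //.
exact: IH.
Qed.

Lemma runs_while b c (q : cstate c) s1 n1 s2 n2 s3 :
  runs q s1 n1 s2 -> runs (None : cstate (While b c)) s2 n2 s3 ->
  runs (Some q : cstate (While b c)) s1 (n1 + n2) s3.
Proof.
move=> r1 r2; elim: r1 r2 => {q s1 n1 s2} [q s h|q s q' n s' h _ IH] r2.
  by apply: (@runs_step (While b c) (Some q) s None); rewrite /= ?h.
by apply: (@runs_step (While b c) (Some q) s (Some q')); rewrite /= ?h //; apply: IH.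
Qed.

Lemma exec_runs c s n s' : exec c s n s' -> runs (cstart c) s n s'.
Proof.
elim=> {c s n s'} [f s|c d s1 n1 s2 n2 s3 _ IH1 _ IH2|b c s h|b c s1 n1 s2 n2 s3 h _ IH1 _ IH2].
- exact: (@runs_exit (Act f) tt).
- exact: runs_seq IH1 IH2.
- by apply: (@runs_exit (While b c) None); rewrite /= h.
- apply: (@runs_step (While b c) None s1 (Some (cstart c))); rewrite /= ?h //.
  by rewrite upd_same; apply: runs_while IH1 IH2.
Qed.

Definition execb c s n s' := exists2 n', n' <= n & exec c s n' s'.

Lemma execb_act f s s' : upd (f (rd s)) s = s' -> execb (Act f) s 1 s'.
Proof. by move=> <-; exists 1 => //; apply: exec_act. Qed.

Lemma execb_seq c d s1 n1 s2 n2 s3 :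
  execb c s1 n1 s2 -> execb d s2 n2 s3 -> execb (Seq c d) s1 (n1 + n2) s3.
Proof.
move=> [m1 h1 e1] [m2 h2 e2]; exists (m1 + m2); first exact: leq_add.
exact: exec_seq e1 e2.
Qed.

Lemma execb_le c s n n' s' : n <= n' -> execb c s n s' -> execb c s n' s'.
Proof. by move=> h [m hm e]; exists m => //; apply: leq_trans hm h. Qed.

(** The family [st] is indexed by the number of iterations still to come, so a loop runs from [st N]
    down to [st 0]. *)
Lemma execb_while (b : readings -> bool) c (st : nat -> memory) n N :
  (forall i, i < N -> b (rd (st i.+1)) /\ execb c (st i.+1) n (st i)) ->
  b (rd (st 0)) = false -> execb (While b c) (st N) (N * n.+1).+1 (st 0).
Proof.
move=> hb h0; elim: N hb => [|N IH] hb.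
  by exists 1 => //; rewrite -{2}[st 0]upd_same; apply: exec_done.
have [bN [m hm e]] := hb N (leqnn _).
have [|m' hm' e'] := IH; first by move=> i hi; apply: hb; apply: ltnW.
exists (m + m').+1; last exact: exec_loop bN e e'.
rewrite mulSn -addnS; lia.
Qed.

End Programs.
Arguments init_memory : clear implicits.

(** * Compiling programs to deterministic machines *)

Section Compilation.
Variables (A T : finType) (c : cmd A T) (b : readings A T -> bool).

Definition tape_index (t : option T) : 'I_#|T|.+1 :=
  if t is Some u then lift ord0 (enum_rank u) else ord0.
Definition index_tape (i : 'I_#|T|.+1) : option T :=
  omap enum_val (unlift ord0 i).

Lemma tape_indexK : cancel tape_index index_tape.
Proof.
by case=> [u|]; rewrite /index_tape /= ?liftK ?unlift_none //= enum_rankK.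
Qed.

(** Acceptance depends on the state alone, so after the program one more step evaluates [b] and
    stores the verdict in a halting state. *)
Definition program_trans (q : (cstate c + option bool)%type)
    (r : {ffun 'I_#|T|.+1 -> symbol A}) :
    seq ((cstate c + option bool)%type * {ffun 'I_#|T|.+1 -> symbol A * Defs.move}) :=
  let r' t := r (tape_index t) in
  match q with
  | inl q => let qa := cstep q r' in
      [:: (if qa.1 is Some q' then inl q' else inr None,
           [ffun i => qa.2 (index_tape i)])]
  | inr None => [:: (inr (Some (b r')), [ffun i => (r i, Stay)])]
  | inr (Some _) => [::]
  end.

Definition program_tm : tm := TM (inl (cstart c)) program_trans.
Definition program_acceptor : acceptor :=
  @Acceptor program_tm (fun q => if q is inr (Some v) then v else false).

Lemma program_deterministic : deterministic program_tm.
Proof. by move=> [q|[v|]] r. Qed.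

Definition config_represents (k : config program_tm) (s : memory A T) : Prop :=
  forall t, represents id (k.2 (tape_index t)) (s t).

Lemma config_readings k s : config_represents k s ->
  (fun t => [ffun i => read (k.2 i)] (tape_index t)) = rd s.
Proof.
move=> h; apply: functional_extensionality => t; rewrite ffunE.
exact: (represents_read (h t)).
Qed.

Lemma config_init x : config_represents (init program_tm x) (init_memory A T x).
Proof.
case=> [t|]; rewrite /init /= ffunE /=.
  by split=> i; rewrite nth_nil.
by split=> i /=; rewrite ?GRing.add0r ?nth_nil //; case: i.
Qed.

Lemma config_step (k : config program_tm) q s : k.1 = inl q -> config_represents k s ->
  exists k', [/\ successors k = [:: k'],
    k'.1 = (if (cstep q (rd s)).1 is Some q' then inl q' else inr None) &
    config_represents k' (upd (cstep q (rd s)).2 s)].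
Proof.
case: k => q0 ts /= -> h; rewrite /successors /=.
have -> : (fun t => [ffun i => read (ts i)] (tape_index t)) = rd s.
  exact (@config_readings (inl q, ts) s h).
eexists; split; first by [].
  by [].
move=> t /=; rewrite !ffunE tape_indexK.
exact: (@represents_step _ _ id) (h t).
Qed.

Lemma config_runs q s n s' (k : config program_tm) :
  runs q s n s' -> k.1 = inl q -> config_represents k s ->
  exists ks, [/\ computation k ks, size ks = n.+1, halted (last k ks) &
    (last k ks).1 = inr (Some (b (rd s')))].
Proof.
move=> r; elim: r k => {q s n s'} [q s h|q s q' n s' h _ IH] k kq ks;
  have [k' [e1 e2 e3]] := config_step kq ks; rewrite h in e2.
  case: k' e1 e2 e3 => q1 ts e1 /= eq1 e3; subst q1.
  pose k2 : config program_tm :=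
    (inr (Some (b (rd (upd (cstep q (rd s)).2 s)))),
      [ffun i => shift Stay (write (read (ts i)) (ts i))]).
  have e4 : successors ((inr None, ts) : config program_tm) = [:: k2].
    rewrite /successors /=; congr [:: (inr (Some (b _)), _)].
      exact (@config_readings (inr None, ts) _ e3).
    by apply/ffunP => i; rewrite !ffunE.
  exists [:: (inr None, ts); k2]; split=> //=.
  by rewrite /computation /= e1 e4 !inE !eqxx.
have [l [l1 l2 l3 l4]] := IH _ e2 e3.
by exists (k' :: l); split=> //=; rewrite ?l2 // /computation /= e1 inE eqxx.
Qed.
End Compilation.

Section Determinism.
Variables (M : tm) (Mdet : deterministic M).

Lemma successors_le1 (k : config M) : size (successors k) <= 1.
Proof. by rewrite size_map; apply: Mdet. Qed.

(** With at most one successor everywhere, any computation is a prefix of the halting one. This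
    carries the time bound and the verdict of one constructed run over to all runs. *)
Lemma computation_le (k : config M) ks ks' :
  computation k ks -> halted (last k ks) -> computation k ks' ->
  size ks' <= size ks /\ (halted (last k ks') -> last k ks' = last k ks).
Proof.
rewrite /computation; elim: ks k ks' => [|k1 ks IH] k [|k1' ks'] //=.
- by move=> _ h /andP[]; move: h; rewrite /halted; case: successors.
- by move=> /andP[h _] _ _; split=> //; move: h; rewrite /halted; case: successors.
move=> /andP[h1 p1] hh /andP[h1' p1'].
have e : k1' = k1.
  move: h1 h1' (successors_le1 k); case: successors => [|a [|]] //.
  by rewrite !inE => /eqP-> /eqP->.
by rewrite e in p1' *; have [] := IH _ _ p1 hh p1'.
Qed.
End Determinism.

Theorem program_in_P (A T : finType) (c : cmd A T) (b : readings A T -> bool)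
    (L : language) F :
  poly_bounded F ->
  (forall x, exists2 s, execb c (init_memory A T x) (F (size x)) s & b (rd s) <-> L x) ->
  in_P L.
Proof.
move=> pF h; exists (program_acceptor c b); first exact: program_deterministic.
have key x : exists s ks, [/\ computation (init (program_tm c b) x) ks,
    size ks <= (F (size x)).+1, halted (last (init (program_tm c b) x) ks),
    (last (init (program_tm c b) x) ks).1 = inr (Some (b (rd s))) & b (rd s) <-> L x].
  have [s [n hn /exec_runs r] e] := h x; exists s.
  have [|ks [k1 k2 k3 k4]] := @config_runs _ _ c b _ _ _ _ (init (program_tm c b) x) r (erefl _).
    exact: config_init.
  by exists ks; split=> //; rewrite k2.
split=> [x|].
  have [s [ks [k1 k2 k3 k4 e]]] := key x; split.
    case=> ks' p' /andP[h' a'].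
    have [_ /(_ h') e'] := computation_le (@program_deterministic _ _ c b) k1 k3 p'.
    by apply/e; move: a'; rewrite /= e' k4.
  by move=> /e bs; exists ks => //=; rewrite k3 k4.
have [p hp] := pb_polyP (pb_add pF (pb_const 1)).
exists p => x ks' p'; have [s [ks [k1 k2 k3 _ _]]] := key x.
have [le _] := computation_le (@program_deterministic _ _ c b) k1 k3 p'.
apply: leq_trans (hp _); rewrite addn1; exact: leq_trans le k2.
Qed.

(** * Simple graphs and rooted trees *)

Section SimpleGraphs.
Variable V : finType.
Implicit Types (G H T : graph V) (E : rel V) (W : {set V}).

Lemma set2_eq (u v w z : V) : [set u; v] = [set w; z] ->
  (u = w /\ v = z) \/ (u = z /\ v = w).
Proof.
move=> e; have h x : (x \in [set u; v]) = (x \in [set w; z]) by rewrite e.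
move: (h u) (h v) (h w) (h z); rewrite !inE !eqxx !orbT /=.
by do 2! [move=> /esym/orP[]/eqP ?]; do 2! [move=> /orP[]/eqP ?]; subst; auto.
Qed.

Lemma adjC H u v : adj H u v = adj H v u.
Proof. by rewrite /adj setUC. Qed.

Lemma adj_vertices H u v : adj H u v ->
  [/\ u != v, u \in vertices H & v \in vertices H].
Proof.
move=> h; have := graphP H => /forall_inP/(_ _ h)/andP[].
rewrite cards2 subUset !sub1set => /eqP n /andP[uH vH]; split=> //.
by apply/eqP => e; rewrite e eqxx in n.
Qed.

Lemma degree_neighbours H v : degree H v = #|[set w | adj H v w]|.
Proof.
rewrite /degree -(card_imset _ (f := fun w => [set v; w])).
  apply: eq_card => e; rewrite !inE; apply/andP/imsetP => [[eH ve]|[w]].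
    have := graphP H => /forall_inP/(_ _ eH)/andP[/cards2P[a [b [_ e']]] _].
    move: ve eH; rewrite e' !inE => /orP[]/eqP<- h.
      by exists b; rewrite ?inE.
    by exists a; rewrite 1?setUC // inE adjC.
  by rewrite inE => vw ->; split=> //; apply: set21.
by move=> w z /set2_eq[[]|[] -> ->].
Qed.

Lemma internalP H v w z : w != z -> adj H v w -> adj H v z -> internal H v.
Proof.
move=> n vw vz; have [_ vH _] := adj_vertices vw.
rewrite /internal vH /= /leaf vH /= degree_neighbours.
apply/negP => /eqP/eqP/cards1P[x e].
have : w \in [set x] by rewrite -e inE.
have : z \in [set x] by rewrite -e inE.
by rewrite !inE => /eqP zx /eqP wx; rewrite zx wx eqxx in n.
Qed.

(** Internal only means that the degree is not 1. A path to another vertex excludes degree 0, so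
    there are two neighbours, one of which differs from [w0]. *)
Lemma internal_neighbour H v u w0 : internal H v -> u != v -> connect (adj H) v u ->
  exists2 w, adj H v w & w != w0.
Proof.
move=> /andP[vH nl] uv /connectP[[|w p] /= pth eu].
  by rewrite eu eqxx in uv.
case/andP: pth => vw _.
have : degree H v != 1 by move: nl; rewrite /leaf vH.
rewrite degree_neighbours => n.
have h : w \in [set w | adj H v w] by rewrite inE.
have [e|//] := eqVneq w w0; last by exists w.
have [z /=] : exists z, z \in [set w | adj H v w] :\ w0.
  apply/set0Pn; apply/negP => /eqP e0; move: n.
  by rewrite (cardsD1 w0) -e h e e0 cards0.
by rewrite !inE => /andP[zw vz]; exists z.
Qed.

Section RelationGraph.
Variables (U : {set V}) (E : rel V).
Hypothesis EU : forall u v, E u v -> [/\ u != v, u \in U & v \in U].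

Definition relation_edges := [set e | [exists u, exists v, E u v && (e == [set u; v])]].

Lemma relation_graphP :
  [forall e in relation_edges, (#|e| == 2) && (e \subset U)].
Proof.
apply/forall_inP => e; rewrite inE => /existsP[u /existsP[v /andP[/EU[n uU vU] /eqP->]]].
by rewrite cards2 n subUset !sub1set uU vU.
Qed.

Definition relation_graph := Graph relation_graphP.

Lemma adj_relation u v : adj relation_graph u v = E u v || E v u.
Proof.
rewrite /adj /= inE; apply/idP/idP.
  by case/existsP=> a /existsP[b /andP[h /eqP/set2_eq[[-> ->]|[-> ->]]]]; rewrite h ?orbT.
by case/orP=> h; apply/existsP; [exists u|exists v]; apply/existsP; [exists v|exists u];
  rewrite h 1?setUC eqxx.
Qed.
End RelationGraph.

Section RootedTree.
Variables (U : {set V}) (r : V) (parent : V -> V) (rank : V -> nat).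
Hypothesis rU : r \in U.
Hypothesis parentP : forall v, v \in U -> v != r ->
  parent v \in U /\ rank (parent v) < rank v.

Definition parent_rel : rel V := fun v w => [&& v \in U, v != r & w == parent v].

Lemma parent_relP u v : parent_rel u v -> [/\ u != v, u \in U & v \in U].
Proof.
case/and3P=> uU ur /eqP->; have [pU h] := parentP uU ur; split=> //.
by apply/eqP => e; rewrite -e ltnn in h.
Qed.

Definition parent_graph := relation_graph parent_relP.

Lemma parent_adj v : v \in U -> v != r -> adj parent_graph v (parent v).
Proof. by move=> vU vr; rewrite adj_relation /parent_rel vU vr eqxx. Qed.

Lemma parent_tree : tree parent_graph.
Proof.
have root v : v \in U -> connect (adj parent_graph) v r.
  have [k] := ubnP (rank v); elim: k v => // k IH v hk vU.
  have [->|vr] := eqVneq v r; first exact: connect0.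
  have [pU h] := parentP vU vr.
  apply: connect_trans (connect1 (parent_adj vU vr)) (IH _ _ pU); lia.
have sym : connect_sym (adj parent_graph).
  by apply: sym_connect_sym => u v; apply: adjC.
split; first split.
- by apply/set0Pn; exists r.
- move=> u v uU vU; rewrite /has_path uU vU /=.
  by apply: connect_trans (root _ uU) _; rewrite sym root.
(* On a cycle, both neighbours of a vertex of maximal rank are its parent. *)
move=> c /andP[cyc uc]; rewrite leqNgt; apply/negP => sz.
have [v0 v0c] : exists v0, v0 \in c by case: (c) sz => // a s _; exists a; rewrite mem_head.
case: (arg_maxnP (P := fun v => v \in c) rank v0c) => v vc vmax.
have [i s e] := rot_to vc.
have cyc' : cycle (adj parent_graph) (v :: s) by rewrite -e rot_cycle.
have uc' : uniq (v :: s) by rewrite -e rot_uniq.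
have mc w : w \in v :: s -> rank w <= rank v by rewrite -e mem_rot => /vmax.
have sz' : size (v :: s) > 2 by rewrite -e size_rot.
have up w : w \in v :: s -> adj parent_graph v w -> w = parent v.
  move=> /mc le; rewrite adj_relation => /orP[] /and3P[xU xr /eqP] // ev.
  by have [_] := parentP xU xr; rewrite -ev; lia.
case: s cyc' uc' mc sz' up {e} => [|w s] //=.
rewrite rcons_path => /and3P[vw pth lv] /and3P[vn wn us] _ sz' up.
have ew := up w _ vw; rewrite inE in ew; rewrite !inE eqxx orbT in ew.
have lm : last w s \in s by case: (s) sz' => //= a l _; apply: mem_last.
have el : last w s = parent v.
  by apply: up; rewrite 1?adjC // !inE lm !orbT.
by move: wn; rewrite ew // -el lm.
Qed.
End RootedTree.
End SimpleGraphs.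

(** * From tilings to internal Steiner trees *)

Variant role := Nu | Mu | Nn | Gg | Ga | Pp.

Definition role_code (x : role) : 'I_6 :=
  inord (match x with Nu => 0 | Mu => 1 | Nn => 2 | Gg => 3 | Ga => 4 | Pp => 5 end).
Definition role_decode (i : 'I_6) : role :=
  match val i with 0 => Nu | 1 => Mu | 2 => Nn | 3 => Gg | 4 => Ga | _ => Pp end.
Lemma role_codeK : cancel role_code role_decode.
Proof. by case; rewrite /role_code /role_decode /= inordK. Qed.
HB.instance Definition _ := Finite.copy role (can_type role_codeK).

Section VertexTypes.
Variable L : finType.

(** For a copy of the label [l], the triple [(s, o, m)] names the other label [m] and the direction
    [o]; if [s] holds, [m] is in the cell at [+ offset C o], otherwise in the cell at
    [- offset C o]. *)
Definition conflict : Type := (bool * bool * L)%type.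
Definition num_conflicts := #|{: conflict}|.

(** [VG] is the ground, [VK] the terminal that grounds [VC], and [Ga] the one that grounds [Gg].
    [VZ l] offers a further edge to the last [Gg] of [l], which has no next copy. Every cell has all
    types, but only the [VG] of cell 0 has edges. *)
Inductive vtype :=
| VG | VC | VK | VZ of L | VX of role & L & 'I_num_conflicts.

Definition vtype_code (t : vtype) :
    option (option (option (L + role * L * 'I_num_conflicts))) :=
  match t with
  | VG => None | VC => Some None | VK => Some (Some None)
  | VZ l => Some (Some (Some (inl l)))
  | VX r l j => Some (Some (Some (inr (r, l, j))))
  end.
Definition vtype_decode x : vtype :=
  match x with
  | None => VG | Some None => VC | Some (Some None) => VK
  | Some (Some (Some (inl l))) => VZ l
  | Some (Some (Some (inr (r, l, j)))) => VX r l j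
  end.
Lemma vtype_codeK : cancel vtype_code vtype_decode.
Proof. by case. Qed.
HB.instance Definition _ := Finite.copy vtype (can_type vtype_codeK).

Definition is_terminal (t : vtype) : bool :=
  match t with
  | VC | VK | VX Mu _ _ | VX Nn _ _ | VX Gg _ _ | VX Ga _ _ => true
  | _ => false
  end.
End VertexTypes.
Arguments VG {L}.
Arguments VC {L}.
Arguments VK {L}.

Definition offset (C : nat) (o : bool) : nat := if o then C else 1.

Variant mark := MZero | MOff of bool & bool | MNone.

(* [MOff true o] marks the offset [offset C o], [MOff false o] its opposite. *)
Definition mark_at (C : nat) (z : int) : mark :=
  if z == 0%R then MZero
  else if z == 1%R then MOff true false
  else if z == (-1)%R then MOff false false
  else if z == Posz C then MOff true true
  else if z == (- C%:Z)%R then MOff false true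
  else MNone.

Definition mark_flip (m : mark) : mark :=
  if m is MOff s o then MOff (~~ s) o else m.

Definition is_zero m := if m is MZero then true else false.
Definition is_minus m o := if m is MOff false o' then o == o' else false.

Section Marks.
Variables (C : nat).
Hypothesis C2 : 1 < C.

Lemma mark_flipE z : mark_flip (mark_at C z) = mark_at C (- z)%R.
Proof. by rewrite /mark_at; do !case: eqP => //=; lia. Qed.

Lemma is_zeroE (p q : nat) : is_zero (mark_at C (q%:Z - p%:Z)%R) = (p == q).
Proof. by rewrite /mark_at; do !case: eqP => //=; lia. Qed.

Lemma is_minusE (p q : nat) o :
  is_minus (mark_at C (q%:Z - p%:Z)%R) o = (p == q + offset C o).
Proof. by rewrite /mark_at; case: o; do !case: eqP => //=; lia. Qed.
End Marks.

Section Adjacency.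
Variables (L : finType) (info : Type).
Variables (allow : info -> L -> bool) (border : info -> bool -> bool).
Variable R : bool -> rel L.

Definition conf (j : 'I_(num_conflicts L)) : conflict L := enum_val j.
Definition cidx (k : conflict L) : 'I_(num_conflicts L) := enum_rank k.

Lemma conf_cidx k : conf (cidx k) = k. Proof. exact: enum_rankK. Qed.
Lemma cidx_conf j : cidx (conf j) = j. Proof. exact: enum_valK. Qed.

(* The exit shared by two conflicting labels belongs to the cell on the left; the
   other side has an exit of its own only if there is no conflict. *)
Definition own_exit (i : info) (l : L) (j : 'I_(num_conflicts L)) : bool :=
  let: (s, o, m) := conf j in [|| s, R o m l | border i o].

Definition arc (i i' : info) (d : mark) (t t' : vtype L) : bool :=
  match t, t' with
  | VC, VK => is_zero d
  | VK, VG => border i' false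
  | VX Ga _ _, VG => border i' false
  | VX Ga l j, VX Gg l' j' => [&& is_zero d, l == l' & j == j']
  | VC, VX Nu l j => [&& is_zero d, allow i l & val j == 0]
  | VX Gg l j, VX Nu l' j' => [&& is_zero d, l == l' & val j' == j.+1]
  | VX Gg l j, VZ l' => [&& is_zero d, l == l' & j.+1 == num_conflicts L]
  | VX Nu l j, VX Mu l' j' => [&& is_zero d, l == l' & j == j']
  | VX Mu l j, VX Nn l' j' => [&& is_zero d, l == l' & j == j']
  | VX Nn l j, VX Gg l' j' => [&& is_zero d, l == l' & j == j']
  | VX Nn l j, VX Pp l' j' =>
      let: (s, o, m) := conf j in
      [&& is_zero d, l == l', j == j' & own_exit i l j] ||
      [&& ~~ s, ~~ R o m l, is_minus d o, l' == m & conf j' == (true, o, l)]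
  | _, _ => false
  end.

(** The arguments range over finite data that three heads can show, so a single machine step
    computes an entry of the adjacency matrix. *)
Definition edge_bit (i i' : info) (d : mark) (t t' : vtype L) : bool :=
  arc i i' d t t' || arc i' i (mark_flip d) t' t.

Variables (C P : nat) (I : nat -> info).
Hypothesis C2 : 1 < C.
Hypothesis P0 : 0 < P.
Hypothesis borderE : forall p o, p < P -> border (I p) o = (p < offset C o).

Definition place : Type := (nat * vtype L)%type.

Definition link (x y : place) : bool :=
  edge_bit (I x.1) (I y.1) (mark_at C (y.1%:Z - x.1%:Z)%R) x.2 y.2.

Definition larc (x y : place) : bool :=
  arc (I x.1) (I y.1) (mark_at C (y.1%:Z - x.1%:Z)%R) x.2 y.2.

Lemma linkE x y : link x y = larc x y || larc y x.
Proof.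
rewrite /link /edge_bit /larc; congr (_ || _).
by rewrite mark_flipE //; congr (arc _ _ (mark_at _ _) _ _); lia.
Qed.

Lemma linkC x y : link x y = link y x.
Proof. by rewrite !linkE orbC. Qed.

Lemma link_irr x : link x x = false.
Proof. by rewrite linkE orbb /larc; case: x => p [| | |l|[] l j]. Qed.

Ltac link_cases y :=
  case: y => q [| | |l'|[] l' j'] hq; rewrite linkE /larc /= ?is_zeroE ?borderE ?orbF //.

(** These inversions list the possible neighbours of each kind of terminal. Two possibilities force
    both edges; more of them leave a choice. *)
Lemma link_Mu p l j y : p < P -> y.1 < P -> link (p, VX Mu l j) y ->
  y = (p, VX Nu l j) \/ y = (p, VX Nn l j).
Proof.
by move=> hp; link_cases y => /and3P[/eqP-> /eqP-> /eqP->]; auto.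
Qed.

Lemma link_Ga p l j y : p < P -> y.1 < P -> link (p, VX Ga l j) y ->
  y = (0, VG) \/ y = (p, VX Gg l j).
Proof.
move=> hp; link_cases y; first by rewrite ltnS leqn0 => /eqP->; auto.
by move=> /and3P[/eqP-> /eqP-> /eqP->]; auto.
Qed.

Lemma link_VK p y : p < P -> y.1 < P -> link (p, VK) y ->
  y = (p, VC) \/ y = (0, VG).
Proof.
move=> hp; link_cases y; first by rewrite ltnS leqn0 => /eqP->; auto.
by move=> /eqP->; auto.
Qed.

Lemma link_VC p y : p < P -> y.1 < P -> link (p, VC) y ->
  y = (p, VK) \/ exists l j, [/\ y = (p, VX Nu l j), allow (I p) l & val j = 0].
Proof.
move=> hp; link_cases y; first by move=> /eqP->; auto.
by move=> /and3P[/eqP-> ? /eqP ?]; right; exists l', j'.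
Qed.

Lemma link_Gg p l j y : p < P -> y.1 < P -> link (p, VX Gg l j) y ->
  [\/ y = (p, VX Ga l j), y = (p, VX Nn l j),
     exists2 j', y = (p, VX Nu l j') & val j' = j.+1 |
     y = (p, VZ l) /\ j.+1 = num_conflicts L].
Proof.
move=> hp; link_cases y.
- by move=> /and3P[/eqP-> /eqP-> /eqP ?]; apply: Or44.
- by move=> /and3P[/eqP-> /eqP-> /eqP ?]; apply: Or43; exists j'.
- by move=> /and3P[/eqP-> /eqP-> /eqP->]; apply: Or42.
- by move=> /and3P[/eqP-> /eqP-> /eqP->]; apply: Or41.
Qed.

Lemma link_Nn p l j y : p < P -> y.1 < P -> link (p, VX Nn l j) y ->
  [\/ y = (p, VX Mu l j), y = (p, VX Gg l j),
     y = (p, VX Pp l j) /\ own_exit (I p) l j |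
     exists o m q, [/\ conf j = (false, o, m), ~~ R o m l, p = q + offset C o &
       y = (q, VX Pp m (cidx (true, o, l)))]].
Proof.
move=> hp; link_cases y.
- by move=> /and3P[/eqP-> /eqP-> /eqP->]; apply: Or41.
- by move=> /and3P[/eqP-> /eqP-> /eqP->]; apply: Or42.
case ej: (conf j) => [[s o] m] /orP[].
  by move=> /and4P[/eqP-> /eqP-> /eqP-> ?]; apply: Or43.
rewrite is_minusE // => /and5P[ns nR /eqP pE /eqP-> /eqP ej'].
apply: Or44; exists o, m, q; split=> //; first by case: s ej ns.
by rewrite -ej' cidx_conf.
Qed.

Definition tiling (f : nat -> L) : Prop :=
  (forall p, p < P -> allow (I p) (f p)) /\
  (forall p o, p + offset C o < P -> R o (f p) (f (p + offset C o))).

Variables (V : finType) (mk : place -> V) (vp : V -> place).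
Hypothesis vpK : cancel vp mk.
Hypothesis mkK : forall x, x.1 < P -> vp (mk x) = x.
Hypothesis vp_lt : forall v, (vp v).1 < P.

Definition host_rel : rel V := fun u v => link (vp u) (vp v).

Lemma host_relP u v : host_rel u v -> [/\ u != v, u \in [set: V] & v \in [set: V]].
Proof.
move=> h; split; rewrite ?in_setT //; apply/eqP => e.
by rewrite /host_rel e link_irr in h.
Qed.

Definition host_graph := relation_graph host_relP.
Definition host_terminals := [set v | is_terminal (vp v).2].

Lemma host_adj u v : adj host_graph u v = link (vp u) (vp v).
Proof. by rewrite adj_relation /host_rel linkC orbb. Qed.

(** * From an internal Steiner tree to a tiling *)

Section Soundness.
Variable T : graph V.
Hypothesis Tist : internal_steiner_tree host_graph host_terminals T.

Local Notation a x y := (adj T (mk x) (mk y)).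

Lemma adj_link x y : x.1 < P -> y.1 < P -> a x y -> link x y.
Proof.
move=> hx hy; case: Tist => -[/andP[_ /subsetP sE] _ _] _ h.
by rewrite -{1}(mkK hx) -{1}(mkK hy) -host_adj; apply: sE.
Qed.

Lemma terminal_neighbour x y : x.1 < P -> is_terminal x.2 ->
  exists z, [/\ z.1 < P, a x z, link x z & z <> y].
Proof.
move=> hx tx; have [[_ _ hp] hi] := Tist.
have xW : mk x \in host_terminals by rewrite inE mkK.
(* Cell 0 always provides a terminal other than [x], to which the Steiner tree connects [x]. *)
pose u0 := if x == (0, VC) then mk (0, VK) else mk (0, VC).
have uW : u0 \in host_terminals by rewrite inE /u0; case: ifP; rewrite mkK.
have nu : u0 != mk x.
  apply/eqP => /(congr1 vp); rewrite /u0 (mkK hx).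
  by case: eqP => e; rewrite mkK // => e'; [rewrite e in e'|case: e].
have /and3P[_ _ c] := hp _ _ xW uW.
have [w xw nw] := internal_neighbour (mk y) (hi _ xW) nu c.
exists (vp w); rewrite vpK; split=> //; first by apply: adj_link; rewrite ?vpK.
by move=> e; rewrite -e vpK eqxx in nw.
Qed.

Lemma acyclicT (s : seq place) : 2 < size s -> all (fun x => x.1 < P) s -> uniq s ->
  cycle (fun x y => a x y) s -> False.
Proof.
move=> sz sP us cs; case: Tist => -[_ [_ ac] _] _.
suff /ac : ucycle (adj T) (map mk s) by rewrite size_map leqNgt sz.
rewrite /ucycle cycle_map (eq_cycle (e' := fun x y => a x y)) // cs /=.
rewrite map_inj_in_uniq // => x y /(allP sP) hx /(allP sP) hy /(congr1 vp).
by rewrite !mkK.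
Qed.

Lemma Mu_edges p l j : p < P ->
  a (p, VX Nu l j) (p, VX Mu l j) /\ a (p, VX Mu l j) (p, VX Nn l j).
Proof.
move=> hp; split.
  have [//|//|z [hz az lz nz]] := @terminal_neighbour (p, VX Mu l j) (p, VX Nn l j).
  by rewrite adjC; case: (link_Mu hp hz lz) => e; rewrite -e in nz *.
have [//|//|z [hz az lz nz]] := @terminal_neighbour (p, VX Mu l j) (p, VX Nu l j).
by case: (link_Mu hp hz lz) => e; rewrite -e in nz *.
Qed.

Lemma Ga_edges p l j : p < P ->
  a (0, VG) (p, VX Ga l j) /\ a (p, VX Ga l j) (p, VX Gg l j).
Proof.
move=> hp; split.
  have [//|//|z [hz az lz nz]] := @terminal_neighbour (p, VX Ga l j) (p, VX Gg l j).
  by rewrite adjC; case: (link_Ga hp hz lz) => e; rewrite -e in nz *.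
have [//|//|z [hz az lz nz]] := @terminal_neighbour (p, VX Ga l j) (0, VG).
by case: (link_Ga hp hz lz) => e; rewrite -e in nz *.
Qed.

Lemma VK_edges p : p < P -> a (0, VG) (p, VK) /\ a (p, VK) (p, VC).
Proof.
move=> hp; split.
  have [//|//|z [hz az lz nz]] := @terminal_neighbour (p, VK) (p, VC).
  by rewrite adjC; case: (link_VK hp hz lz) => e; rewrite -e in nz *.
have [//|//|z [hz az lz nz]] := @terminal_neighbour (p, VK) (0, VG).
by case: (link_VK hp hz lz) => e; rewrite -e in nz *.
Qed.

(* [fed p l j]: the [j]-th copy of the label [l] is joined to the ground, by a
   path [G - z - x - Nu] that avoids the rest of this copy. *)
Definition fed p l (j : 'I_(num_conflicts L)) : Prop :=
  exists2 xz : vtype L * vtype L,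
    xz = (VC, VK) \/ exists2 i : 'I_(num_conflicts L), i < j & xz = (VX Gg l i, VX Ga l i)
  & a (p, xz.1) (p, VX Nu l j).

Lemma fed_path p l j : p < P -> fed p l j ->
  exists2 xz : vtype L * vtype L,
    xz = (VC, VK) \/ exists2 i : 'I_(num_conflicts L), i < j & xz = (VX Gg l i, VX Ga l i)
  & [/\ a (0, VG) (p, xz.2), a (p, xz.2) (p, xz.1), a (p, xz.1) (p, VX Nu l j),
      a (p, VX Nu l j) (p, VX Mu l j) & a (p, VX Mu l j) (p, VX Nn l j)].
Proof.
move=> hp [xz hxz h]; exists xz => //.
have [m1 m2] := Mu_edges l j hp.
case: hxz h => [|[i _]] -> /= h.
  by have [? ?] := VK_edges hp; split.
by have [? ?] := Ga_edges l i hp; split.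
Qed.

Definition place_key (x : place) : nat * (nat * nat) :=
  (x.1, match x.2 with
        | VG => (0, 0) | VC => (1, 0) | VK => (2, 0) | VZ _ => (3, 0)
        | VX Nu _ j => (4, val j) | VX Mu _ j => (5, val j) | VX Nn _ j => (6, val j)
        | VX Gg _ j => (7, val j) | VX Ga _ j => (8, val j) | VX Pp _ j => (9, val j)
        end).

Lemma fed_not_Gg p l j : p < P -> fed p l j -> ~ a (p, VX Nn l j) (p, VX Gg l j).
Proof.
move=> hp /(fed_path hp)[xz hxz [h1 h2 h3 h4 h5]] h6.
have [g1 g2] := Ga_edges l j hp.
apply: (@acyclicT [:: (0, VG); (p, xz.2); (p, xz.1); (p, VX Nu l j);
  (p, VX Mu l j); (p, VX Nn l j); (p, VX Gg l j); (p, VX Ga l j)]) => //.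
- by rewrite /= hp P0.
- apply: (map_uniq (f := place_key)).
  by case: hxz => [|[i hi]] ->; rewrite /= !inE !xpair_eqE /= ?(ltn_eqF hi) ?(gtn_eqF hi) ?andbF.
- by rewrite /= h1 h2 h3 h4 h5 h6 adjC g2 adjC g1.
Qed.

(** Besides [Ga], the terminal [Gg] needs an edge: [Nn] is excluded by [fed_not_Gg], and [VZ] is
    adjacent to the last copy only, so the [Nu] of the next copy is left. *)
Lemma fed_next p l j j' : p < P -> fed p l j -> val j' = j.+1 -> fed p l j'.
Proof.
move=> hp fj ej; have [//|//|z [hz az lz nz]] :=
  @terminal_neighbour (p, VX Gg l j) (p, VX Ga l j).
case: (link_Gg hp hz lz) => [e|e|[j2 e e2]|[_ e]].
- by rewrite e in nz.
- by case: (fed_not_Gg hp fj); rewrite adjC -e.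
- exists (VX Gg l j, VX Ga l j); first by right; exists j; rewrite ?ej.
  by have -> : j' = j2; [apply: val_inj; rewrite ej|rewrite -e].
- by have := ltn_ord j'; rewrite ej e ltnn.
Qed.

Lemma fed_all p l j0 j : p < P -> fed p l j0 -> val j0 = 0 -> fed p l j.
Proof.
move=> hp f0 e0; case: j => k hk; elim: k hk => [|k IH] hk.
  by have <- : j0 = Ordinal hk by apply: val_inj.
exact: (fed_next hp (IH (ltnW hk))).
Qed.

Lemma fed_exit p l j : p < P -> fed p l j ->
  (own_exit (I p) l j /\ a (p, VX Nn l j) (p, VX Pp l j)) \/
  exists o m q, [/\ conf j = (false, o, m), ~~ R o m l, p = q + offset C o &
       a (p, VX Nn l j) (q, VX Pp m (cidx (true, o, l)))].
Proof.
move=> hp fj; have [//|//|z [hz az lz nz]] :=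
  @terminal_neighbour (p, VX Nn l j) (p, VX Mu l j).
case: (link_Nn hp hz lz) => [e|e|[e h]|[o [m [q [? ? ? e]]]]].
- by rewrite e in nz.
- by case: (fed_not_Gg hp fj); rewrite -e.
- by left; rewrite -e.
- by right; exists o, m, q; rewrite -e.
Qed.

Lemma fed_compatible p l o l' : p + offset C o < P ->
  (forall j, fed p l j) -> (forall j, fed (p + offset C o) l' j) -> R o l l'.
Proof.
set p' := p + offset C o => hp' f f'; case E: (R o l l') => //; exfalso.
have o0 : 0 < offset C o by rewrite /offset; case: (o); lia.
have pp : p < p' by rewrite /p' -addn1 leq_add2l.
have hp : p < P by apply: ltn_trans hp'.
(* The copy of [l] that tests [l'] in the later cell, and the copy of [l'] that tests [l] in the
   earlier one: if the labels conflict, both must use the exit [(p, VX Pp l j)]. *)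
pose j := cidx (true, o, l'); pose j' := cidx (false, o, l).
have h : a (p, VX Nn l j) (p, VX Pp l j).
  case: (fed_exit hp (f j)) => [[]//|[? [? [? []]]]].
  by rewrite conf_cidx.
have h' : a (p', VX Nn l' j') (p, VX Pp l j).
  case: (fed_exit hp' (f' j')) => [[]|[o1 [m [q []]]]].
    by rewrite /own_exit conf_cidx /= E borderE //= /p' ltnNge leq_addl.
  by rewrite conf_cidx => -[<- <-] _ /addIn <-.
have [xz hxz [h1 h2 h3 h4 h5]] := fed_path hp (f j).
have [xz' hxz' [h1' h2' h3' h4' h5']] := fed_path hp' (f' j').
apply: (@acyclicT [:: (0, VG); (p, xz.2); (p, xz.1); (p, VX Nu l j);
  (p, VX Mu l j); (p, VX Nn l j); (p, VX Pp l j); (p', VX Nn l' j');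
  (p', VX Mu l' j'); (p', VX Nu l' j'); (p', xz'.1); (p', xz'.2)]) => //.
- by rewrite /= hp hp' P0.
- apply: (map_uniq (f := place_key)).
  by case: hxz => [|[i hi]] ->; case: hxz' => [|[i' hi']] ->;
    rewrite /= !inE !xpair_eqE /= ?(ltn_eqF pp) ?andbF.
- by rewrite /= h1 h2 h3 h4 h5 h adjC h' adjC h5' adjC h4' adjC h3' adjC h2' adjC h1'.
Qed.

Lemma steiner_tiling : exists f, tiling f.
Proof.
have ex p : p < P -> exists l j, [/\ a (p, VC) (p, VX Nu l j), allow (I p) l & val j = 0].
  move=> hp; have [//|//|z [hz az lz nz]] := @terminal_neighbour (p, VC) (p, VK).
  case: (link_VC hp hz lz) => [e|[l [j [e al ej]]]]; first by rewrite e in nz.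
  by exists l, j; rewrite -e.
have [l0 _] := ex 0 P0.
(* A cell may pick several labels. Any of them will do, since all copies of every picked label are
   grounded. *)
pose good p l := allow (I p) l && [exists j, a (p, VC) (p, VX Nu l j) && (val j == 0)].
pose f p := odflt l0 [pick l | good p l].
have fP p : p < P -> good p (f p).
  rewrite /f => /ex[l [j [h1 h2 h3]]]; case: pickP => //= /(_ l)/negP[].
  by rewrite /good h2; apply/existsP; exists j; rewrite h1 h3 eqxx.
have ff p j : p < P -> fed p (f p) j.
  move=> hp; have /andP[_ /existsP[j0 /andP[h /eqP e]]] := fP p hp.
  by apply: fed_all e => //; exists (VC, VK); first by left.
exists f; split=> [p /fP/andP[]//|p o hp].
apply: (fed_compatible hp) => j; apply: ff => //.
by apply: leq_ltn_trans hp; apply: leq_addr.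
Qed.

End Soundness.

(** * From a tiling to an internal Steiner tree *)

Section Completeness.
Variable f : nat -> L.
Hypothesis ft : tiling f.

Definition last_index (l : L) : 'I_(num_conflicts L) :=
  insubd (cidx (true, true, l)) (num_conflicts L).-1.

Lemma last_indexE l : (last_index l).+1 = num_conflicts L.
Proof.
have h := ltn_ord (cidx (true, true, l)).
rewrite val_insubd; case: ifP; lia.
Qed.

(** A copy of the chosen label hangs from its [Nu], that is from [VC] or from the previous [Gg], and
    an exit hangs from its [Nn]. A copy of any other label is traversed the other way and hangs from
    its own [Gg]. *)
Definition up (x : place) : place :=
  let p := x.1 in
  match x.2 with
  | VG | VK | VX Ga _ _ => (0, VG)
  | VC => (p, VK)
  | VZ l => (p, VX Gg l (last_index l))
  | VX Gg l j => (p, VX Ga l j)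
  | VX Nu l j =>
      if l != f p then (p, VX Mu l j)
      else if val j == 0 then (p, VC) else (p, VX Gg l (insubd j j.-1))
  | VX Mu l j => (p, VX (if l != f p then Nn else Nu) l j)
  | VX Nn l j => (p, VX (if l != f p then Gg else Mu) l j)
  | VX Pp l j =>
      if (l == f p) && own_exit (I p) l j then (p, VX Nn l j)
      else let: (_, o, m) := conf j in (p + offset C o, VX Nn m (cidx (false, o, l)))
  end.

(** An exit is kept only if a copy of a chosen label uses it, either its owner or the conflicting
    label in the later cell. *)
Definition in_tree (x : place) : bool :=
  let p := x.1 in
  match x.2 with
  | VG => p == 0
  | VZ l => l == f p
  | VX Pp l j => (l == f p) && own_exit (I p) l j ||
      let: (s, o, m) := conf j in
      [&& s, ~~ R o l m, p + offset C o < P & m == f (p + offset C o)]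
  | _ => true
  end.

(** The depth of a place of the tree. It does not grow with [j], as every [Gg] is grounded by its
    own [Ga]. *)
Definition rk (x : place) : nat :=
  let p := x.1 in
  match x.2 with
  | VG => 0 | VK => 1 | VC => 2 | VZ _ => 3
  | VX Ga _ _ => 1 | VX Gg _ _ => 2
  | VX Nu l _ => if l != f p then 5 else 3
  | VX Mu l _ => 4
  | VX Nn l _ => if l != f p then 3 else 5
  | VX Pp _ _ => 6
  end.

Lemma upP x : x.1 < P -> in_tree x -> x <> (0, VG) ->
  [/\ (up x).1 < P, in_tree (up x), rk (up x) < rk x & link x (up x)].
Proof.
case: x => p [| | |l|[] l j] hp /= ht nx; rewrite /up /= linkE /larc /rk /=.
- by case: nx; rewrite /in_tree /= in ht; rewrite (eqP ht).
- by rewrite is_zeroE // eqxx hp.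
- by rewrite borderE.
- by rewrite is_zeroE // !eqxx hp last_indexE eqxx ?orbT.
- have [e|ne] := eqVneq l (f p); last by rewrite /= is_zeroE // !eqxx hp ?orbT.
  have [j0|j0] := eqVneq (val j) 0.
    by rewrite /= is_zeroE // eqxx j0 /= e ft.1.
  rewrite /= is_zeroE // !eqxx hp val_insubd.
  have -> : j.-1 < num_conflicts L by have := ltn_ord j; lia.
  by rewrite prednK ?eqxx ?orbT // lt0n.
- by have [e|ne] := eqVneq l (f p); rewrite /= ?(negbTE ne) /= is_zeroE // !eqxx hp ?orbT.
- by have [e|ne] := eqVneq l (f p); rewrite /= ?(negbTE ne) /= is_zeroE // !eqxx hp ?orbT.
- by rewrite is_zeroE // !eqxx hp.
- by rewrite borderE.
have [/andP[/eqP e oe]|] := boolP ((l == f p) && own_exit (I p) l j).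
  by rewrite /= is_zeroE // e eqxx hp -e oe !eqxx; case: (conf j) => [[s o] m].
move=> /negbTE no; move: ht; rewrite /in_tree /= no /=; case ej: (conf j) => [[s o] m] /=.
move=> /and4P[hs nR hpo /eqP em]; rewrite hpo -em eqxx conf_cidx.
split=> //; rewrite is_minusE // eqxx nR eqxx /=.
by rewrite ej hs eqxx orbT.
Qed.

(** A child together with the parent gives two neighbours, which makes a terminal internal. *)
Lemma up_child x : x.1 < P -> is_terminal x.2 ->
  exists y, [/\ y.1 < P, in_tree y, y <> (0, VG) & up y = x].
Proof.
case: x => p [| | |l|[] l j] hp //= _.
- pose j0 : 'I_(num_conflicts L) := insubd (cidx (true, true, f p)) 0.
  have e0 : val j0 = 0.
    by have := ltn_ord (cidx (true, true, f p)); rewrite val_insubd; case: ifP; lia.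
  by exists (p, VX Nu (f p) j0); split=> //; rewrite /up /= eqxx e0.
- by exists (p, VC).
- have [e|ne] := eqVneq l (f p).
    by exists (p, VX Nn l j); split=> //; rewrite /up /= e eqxx.
  by exists (p, VX Nu l j); split=> //; rewrite /up /= ne.
- have [e|ne] := eqVneq l (f p); last first.
    by exists (p, VX Mu l j); split=> //; rewrite /up /= ne.
  have [oe|] := boolP (own_exit (I p) l j).
    by exists (p, VX Pp l j); split=> //; rewrite /in_tree /up /= oe -e eqxx.
  rewrite /own_exit; case ej: (conf j) => [[s o] m] /norP[hs /norP[nR]].
  rewrite borderE // -leqNgt => hq.
  have eq : p - offset C o + offset C o = p by rewrite subnK.
  have hq' : p - offset C o < P by apply: leq_ltn_trans hp; apply: leq_subr.
  (* The tiling respects [R], so the conflicting label [m] is not the one chosen in the earlier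
     cell. Its exit there is therefore free to hang from this [Nn]. *)
  have nm : m != f (p - offset C o).
    apply/eqP => em; case/negP: nR; rewrite em e -{2}eq.
    by apply: ft.2; rewrite eq.
  exists (p - offset C o, VX Pp m (cidx (true, o, l))); split=> //=.
    by rewrite /in_tree /= conf_cidx eq nR hp e eqxx orbT.
  rewrite /up /= (negbTE nm) /= conf_cidx eq; congr (_, VX _ _ _).
  by rewrite -(cidx_conf j) ej; case: s hs ej.
- have [e|ne] := eqVneq l (f p); last first.
    by exists (p, VX Nn l j); split=> //; rewrite /up /= ne.
  have [hj|hj] := ltnP j.+1 (num_conflicts L).
    exists (p, VX Nu l (Ordinal hj)); split=> //; rewrite /up /= e eqxx /=.
    by congr (_, VX _ _ _); apply: val_inj; rewrite val_insubd /= ltn_ord.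
  exists (p, VZ l); split=> //; rewrite /in_tree /up /= ?e ?eqxx //.
  congr (_, VX _ _ _); apply: val_inj; have := last_indexE (f p); have := ltn_ord j.
  by move=> /=; lia.
- by exists (p, VX Gg l j).
Qed.

Definition tree_set := [set v | in_tree (vp v)].
Definition tree_root := mk (0, VG).
Definition tree_parent v := mk (up (vp v)).

Lemma tree_root_in : tree_root \in tree_set.
Proof. by rewrite inE mkK. Qed.

Lemma tree_parentP v : v \in tree_set -> v != tree_root ->
  tree_parent v \in tree_set /\ rk (vp (tree_parent v)) < rk (vp v).
Proof.
rewrite inE => vt nv; have [|h1 h2 h3 _] := upP (vp_lt v) vt.
  by move=> e; rewrite /tree_root -e vpK eqxx in nv.
by rewrite /tree_parent inE mkK.
Qed.

Definition tiling_tree := parent_graph (rank := fun v => rk (vp v)) tree_parentP.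

Lemma tiling_treeP : internal_steiner_tree host_graph host_terminals tiling_tree.
Proof.
have tT : tree tiling_tree := parent_tree tree_root_in tree_parentP.
have WU v : v \in host_terminals -> v \in tree_set.
  by rewrite !inE; case: (vp v) => p [| | |l|[] l j].
split.
  split=> //; last by move=> u v /WU uU /WU vU; apply: tT.1.2.
  apply/andP; split; first exact: subsetT.
  apply/subsetP => e; rewrite inE => /existsP[u /existsP[v /andP[/and3P[uU ur /eqP->] /eqP->]]].
  change (adj host_graph u (tree_parent u)); rewrite host_adj.
  have ut : in_tree (vp u) by rewrite inE in uU.
  have [|h1 h2 h3 h4] := upP (vp_lt u) ut.
    by move=> e'; rewrite /tree_root -e' vpK eqxx in ur.
  by rewrite mkK.
move=> v vW; have vU := WU _ vW.
have vr : v != tree_root.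
  by apply/eqP => e; move: vW; rewrite e inE mkK.
move: (vW); rewrite inE => tv; have [y [y1 y2 y3 y4]] := up_child (vp_lt v) tv.
have yU : mk y \in tree_set by rewrite inE mkK.
have yr : mk y != tree_root.
  by apply/eqP => /(congr1 vp); rewrite !mkK.
have py : tree_parent (mk y) = v by rewrite /tree_parent mkK // y4 vpK.
have [_ lt1] := tree_parentP yU yr; have [_ lt2] := tree_parentP vU vr.
apply: (@internalP _ _ _ (tree_parent v) (mk y)).
- by apply/eqP => e; move: lt1 lt2; rewrite e py; lia.
- exact: parent_adj.
- by rewrite adjC -py; apply: parent_adj.
Qed.
End Completeness.
End Adjacency.

(** * Computation tableaux as tilings *)

Definition move_code (m : Defs.move) : option bool :=
  match m with MoveLeft => Some false | Stay => None | MoveRight => Some true end.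
Definition move_decode (x : option bool) : Defs.move :=
  match x with Some false => MoveLeft | None => Stay | Some true => MoveRight end.
Lemma move_codeK : cancel move_code move_decode.
Proof. by case. Qed.
HB.instance Definition _ := Finite.copy Defs.move (can_type move_codeK).

(* Whether the cell is in the first column, the input bit (or blank) if it is in
   the first row, and whether it is the last cell. *)
Definition cell_info : Type := (bool * option (option bool) * bool)%type.

(** Cells are numbered consecutively, and the last cell of a row precedes the first cell of the next
    row. Hence only cell 0 lacks a predecessor at offset 1. *)
Definition cell_border (i : cell_info) (o : bool) : bool :=
  (o || i.1.1) && isSome i.1.2.

(** The first cell of row [r + 1], which ends the grid after [r + 1] full rows. *)
Definition last_cell (C r : nat) : nat := r.+1 * C.

Definition info_at (x : seq bool) (C r p : nat) : cell_info :=
  (p %% C == 0, if p < C then Some (nth None [seq Some b | b <- x] p) else None,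
   p == last_cell C r).

Lemma info_border x C r p o : 1 < C -> cell_border (info_at x C r p) o = (p < offset C o).
Proof.
move=> C2; rewrite /cell_border /info_at /=; case: (ltnP p C) => hp /=.
  by rewrite andbT modn_small //; case: o => /=; [rewrite hp|rewrite ltnS leqn0].
rewrite andbF; case: o => /=; lia.
Qed.

Section Tableau.
Variable N : acceptor.

Definition content : Type := {ffun 'I_(tapes N).+1 -> symbol (aux N) * symbol (aux N)}.
Definition instruction : Type :=
  (state N * {ffun 'I_(tapes N).+1 -> symbol (aux N) * Defs.move})%type.
(* The current state, and the instruction executed, if any. *)
Definition choice_at : Type := (state N * option instruction)%type.
(* Column [j] holds the [j]-th cells to the left and to the right of each head.
   A label shows three columns: the previous one after writing, the current
   one and the next one. *)
Definition label : finType := (bool * choice_at * (content * content * content))%type.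

Definition first (l : label) := l.1.1.
Definition act (l : label) : choice_at := l.1.2.
Definition prev (l : label) : content := l.2.1.1.
Definition cur (l : label) : content := l.2.1.2.
Definition next (l : label) : content := l.2.2.

Definition init_content (b : option bool) : content :=
  [ffun i => (None, if i == ord0 then omap inl b else None)].

Definition head_symbols (c : content) : {ffun 'I_(tapes N).+1 -> symbol (aux N)} :=
  [ffun i => (c i).2].

(** In the first column, having no instruction means an accepting halt, and the last cell must have
    none. The flag [first] is copied into the label because [label_rel] sees labels only. *)
Definition label_allow (i : cell_info) (l : label) : bool :=
  [&& first l == i.1.1,
      (if i.1.2 is Some b then
         (cur l == init_content b) && (first l ==> ((act l).1 == start N)) else true),
      i.2 ==> ((act l).2 == None)
    & first l ==>
        match (act l).2 with
        | Some a => a \in trans (act l).1 (head_symbols (cur l))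
        | None => nilp (trans (act l).1 (head_symbols (cur l))) && accepting (act l).1
        end].

Definition written_content (fst : bool) (q : choice_at) (c : content) : content :=
  [ffun i => ((c i).1, if q.2 is Some a then if fst then (a.2 i).1 else (c i).2
                       else (c i).2)].

(** A move pushes one half of the folded tape away from the head and pulls the other half in, so it
    consults both adjacent columns. The previous one is taken after writing, as the new symbol of
    column 0 may be pushed into column 1. *)
Definition shifted_content (a : instruction) (l : label) : content :=
  [ffun i => match (a.2 i).2 with
     | Stay => ((cur l i).1, if first l then (a.2 i).1 else (cur l i).2)
     | MoveRight => (if first l then (a.2 i).1 else (prev l i).1, (next l i).2)
     | MoveLeft => ((next l i).1, if first l then (cur l i).1 else (prev l i).2)
     end].

(** For [o] true the cells are in consecutive rows, and a halted row leaves the next one free. The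
    escape [first l'] handles the step from the end of a row to the start of the next. *)
Definition label_rel (o : bool) (l l' : label) : bool :=
  if o then
    if (act l).2 is Some a then ((act l').1 == a.1) && (cur l' == shifted_content a l)
    else true
  else first l' || [&& act l == act l', prev l' == written_content (first l) (act l) (cur l)
                     & cur l' == next l].

Definition column (c : config N) (j : nat) : content :=
  [ffun i => (nth None (c.2 i).1 j, nth None (c.2 i).2 j)].

Definition do_instruction (a : instruction) (c : config N) : config N :=
  (a.1, [ffun i => shift (a.2 i).2 (write (a.2 i).1 (c.2 i))]).

Definition label_of (c : config N) (q : choice_at) (j : nat) : label :=
  (j == 0, q,
   (if j is j'.+1 then written_content (j' == 0) q (column c j') else [ffun=> (None, None)],
    column c j, column c j.+1)).

Lemma column_step a c q j : q.2 = Some a ->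
  column (do_instruction a c) j = shifted_content a (label_of c q j).
Proof.
move=> qa; apply/ffunP => i; rewrite !ffunE /=.
rewrite /first /prev /=; case: j => [|j]; rewrite ?ffunE /= ?qa.
  by case: (a.2 i) => s [] /=; case: (c.2 i) => u v /=; rewrite ?nth_behead ?nth0.
by case: (a.2 i) => s [] /=; case: (c.2 i) => u v /=; rewrite ?nth_behead //; case: j => [|j];
  rewrite /= ?nth_behead.
Qed.

Lemma head_symbols_column c : head_symbols (column c 0) = [ffun i => read (c.2 i)].
Proof. by apply/ffunP => i; rewrite !ffunE nth0. Qed.

Lemma successorsE (c : config N) c' : (c' \in successors c) =
  has (fun a => c' == do_instruction a c) (trans c.1 (head_symbols (column c 0))).
Proof.
rewrite head_symbols_column /successors; apply/mapP/hasP => [[a ha ->]|[a ha /eqP->]];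
  by exists a.
Qed.

Lemma shifted_content_ext a l l' : first l = first l' ->
  (first l = false -> prev l = prev l') -> cur l = cur l' -> next l = next l' ->
  shifted_content a l = shifted_content a l'.
Proof.
move=> e1 e2 e3 e4; apply/ffunP => i; rewrite !ffunE e1 e3 e4.
by case: (first l') e1 e2 => [-> //|-> ->].
Qed.

Lemma column_init x j : column (init N x) j = init_content (nth None [seq Some b | b <- x] j).
Proof.
apply/ffunP => i; rewrite !ffunE /=; case: eqP => _ /=; rewrite !nth_nil //.
congr pair; have [h|h] := ltnP j (size x).
  by rewrite !(nth_map false).
by rewrite !nth_default ?size_map.
Qed.

Variables (x : seq bool) (C r : nat).
Hypothesis rC : r.+1 < C.

Local Notation P := (last_cell C r).+1.
Local Notation tiles := (tiling label_allow label_rel C P (info_at x C r)).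

(** * From a tiling to an accepting computation *)

Section FromTiling.
Variable f : nat -> label.
Hypothesis ft : tiles f.

Local Notation cell t j := (t * C + j).

Lemma cell_lt t j : t <= r -> j < C -> cell t j < P.
Proof. by rewrite /last_cell => ht hj; rewrite ltnS mulSn; nia. Qed.

Lemma first_cell t j : j < C -> cell t j < P -> first (f (cell t j)) = (j == 0).
Proof.
move=> hj /ft.1/andP[/eqP-> _] /=.
by rewrite modnMDl modn_small.
Qed.

Lemma act_cell t j : t <= r -> j < C -> act (f (cell t j)) = act (f (cell t 0)).
Proof.
move=> ht; elim: j => // j IH hj; rewrite -IH; last exact: ltnW.
have h : cell t j + offset C false < P by rewrite /= addn1 -addnS; apply: cell_lt.
have := ft.2 _ _ h; rewrite /= addn1 -addnS first_cell ?cell_lt //=.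
by move=> /and3P[/eqP->].
Qed.

Lemma next_cell t j : t <= r -> j.+1 < C ->
  next (f (cell t j)) = cur (f (cell t j.+1)) /\
  prev (f (cell t j.+1)) =
    written_content (j == 0) (act (f (cell t 0))) (cur (f (cell t j))).
Proof.
move=> ht hj.
have h : cell t j + offset C false < P by rewrite /= addn1 -addnS; apply: cell_lt.
have := ft.2 _ _ h; rewrite /= addn1 -addnS first_cell ?cell_lt //=.
move=> /and3P[_ /eqP-> /eqP->].
by rewrite act_cell ?(ltnW hj) // first_cell ?cell_lt ?(ltnW hj).
Qed.

(* The last column is unconstrained, and errors move left by one column per row. *)
Definition matches (t : nat) (c : config N) : Prop :=
  (act (f (cell t 0))).1 = c.1 /\
  forall j, j + t < C -> cell t j < P -> cur (f (cell t j)) = column c j.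

Lemma matches_step t c : t <= r -> matches t c ->
  (halted c && accepting c.1) \/ exists2 c', c' \in successors c & matches t.+1 c'.
Proof.
move=> ht [m1 m2]; have C0 : 0 < C by lia.
have h0 : cell t 0 < P by apply: cell_lt.
have c0 : cur (f (cell t 0)) = column c 0 by apply: m2 => //; lia.
have := ft.1 _ h0 => /and4P[_ _ _]; rewrite first_cell //= m1 c0.
case ea: (act (f (cell t 0))).2 => [a|]; last first.
  move=> /andP[h1 h2]; left; rewrite h2 andbT /halted /nilp size_map.
  by rewrite -head_symbols_column.
move=> ha; right; exists (do_instruction a c).
  by rewrite successorsE; apply/hasP; exists a.
have down j : cell t.+1 j < P -> j < C ->
    (act (f (cell t.+1 j))).1 = a.1 /\
    cur (f (cell t.+1 j)) = shifted_content a (f (cell t j)).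
  move=> h hj; have e : cell t j + offset C true = cell t.+1 j by rewrite /= mulSn; lia.
  have := ft.2 (cell t j) true; rewrite e => /(_ h).
  by rewrite /= act_cell // ea => /andP[/eqP-> /eqP->].
split; first by apply: (down 0 _ C0).1; rewrite /last_cell; nia.
move=> j hj h; have hj' : j.+1 < C by lia.
rewrite (down j h (ltnW hj')).2 (column_step c j ea).
have [n1 _] := next_cell ht hj'.
apply: shifted_content_ext.
- by rewrite first_cell ?cell_lt // ltnW.
- rewrite first_cell ?cell_lt ?(ltnW hj') //; case: j hj h hj' n1 => //= j hj h hj' n1 _.
  have [_ ->] := next_cell ht (ltnW hj').
  by rewrite m2 //; [lia|apply: cell_lt => //; lia].
- by rewrite m2 //; [lia|apply: cell_lt => //; lia].
- by rewrite n1 m2 //; [lia|apply: cell_lt => //; lia].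
Qed.

Lemma tiling_accepts : accepts N x.
Proof.
have C0 : 0 < C by lia.
have run t : t <= r.+1 -> accepts N x \/
    exists2 cs, computation (init N x) cs & matches t (last (init N x) cs).
  elim: t => [_|t IH ht].
    right; exists [::] => //; split.
      have := ft.1 0 isT => /and4P[_]; rewrite /= C0 => /andP[_].
      have -> : first (f 0) by have := @first_cell 0 0 C0 isT; rewrite mul0n.
      by move=> /eqP.
    move=> j hj h; have := ft.1 _ h => /and4P[_]; rewrite /= mul0n add0n.
    have -> : j < C by lia.
    by move=> /andP[/eqP-> _] _ _; rewrite column_init.
  case: (IH (ltnW ht)) => [|[cs pcs m]]; first by left.
  case: (matches_step ht m) => [hacc|[c' sc' m']]; first by left; exists cs.
  right; exists (rcons cs c'); last by rewrite last_rcons.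
  by rewrite /computation rcons_path; apply/andP.
(* Without an earlier accepting halt, row [r + 1] still matches in column 0, as [r + 1 < C]. That
   cell is the last one; having no instruction, it shows an accepting halt. *)
case: (run r.+1) => // [] [cs pcs [m1 m2]].
have hP : last_cell C r + 0 < P by rewrite addn0.
have := ft.1 _ hP => /and4P[_ _] /=; rewrite addn0 eqxx /= => /eqP ea.
have -> : first (f (last_cell C r)) by have := @first_cell r.+1 0 C0; rewrite addn0 => ->.
have e0 := m2 0; rewrite addn0 in e0; rewrite addn0 in m1.
rewrite /last_cell in ea *.
rewrite ea m1 e0 //= => /andP[h1 h2]; exists cs => //=; rewrite h2 andbT.
by rewrite /halted /nilp size_map -head_symbols_column.
Qed.
End FromTiling.

Lemma accepts_tiling :
  (forall cs, computation (init N x) cs -> size cs <= r) -> accepts N x ->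
  exists f, tiles f.
Proof.
move=> bound [cs pcs /andP[hh hacc]]; have szr := bound _ pcs.
have C0 : 0 < C by lia.
set c0 := init N x in pcs hh hacc *.
(* The default value repeats the last configuration in the rows after the halt, where [inst] is
   [None]. *)
pose ct t := nth (last c0 cs) (c0 :: cs) t.
have ctS t : t < size cs -> ct t.+1 \in successors (ct t).
  by move=> ht; have := pathP (last c0 cs) pcs t ht.
have ct_last t : size cs <= t -> ct t = last c0 cs.
  rewrite /ct leq_eqVlt => /orP[/eqP<-|h]; last by rewrite nth_default.
  by rewrite -last_nth.
pose inst t : option instruction := if t < size cs then
  [pick a : instruction | (a \in trans (ct t).1 (head_symbols (column (ct t) 0))) &&
          (ct t.+1 == do_instruction a (ct t))] else None.
have instP t : t < size cs -> exists a, [/\ inst t = Some a,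
    a \in trans (ct t).1 (head_symbols (column (ct t) 0)) & ct t.+1 = do_instruction a (ct t)].
  move=> ht; rewrite /inst ht; case: pickP => [a /andP[h1 /eqP h2]|no]; first by exists a.
  have := ctS t ht; rewrite successorsE => /hasP[a h1 h2].
  by have := no a; rewrite h1 h2.
pose f p := label_of (ct (p %/ C)) ((ct (p %/ C)).1, inst (p %/ C)) (p %% C).
exists f; split=> [p hp|p o hp].
  apply/and4P; split=> //=.
  - case: ifP => // pC; rewrite /cur /= divn_small // modn_small // column_init eqxx /=.
    by rewrite /act /= eqxx implybT.
  - apply/implyP => /eqP->; rewrite /act /= mulnK // /inst ifF //.
    by apply/negbTE; rewrite -leqNgt ltnW.
  - apply/implyP => /eqP j0; rewrite /act /cur /= j0.
    have [ht|ht] := ltnP (p %/ C) (size cs).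
      by have [a [-> ? _]] := instP _ ht.
    rewrite /inst ifF ?ct_last // 1?ltnNge ?ht //; move: hh; rewrite hacc andbT.
    by rewrite /halted /nilp size_map -head_symbols_column.
case: o hp => /= hp.
  have e1 : (p + C) %/ C = (p %/ C).+1 by rewrite divnDr ?dvdnn // divnn C0 addn1.
  rewrite /f /act e1 modnDr /=; have [ht|ht] := ltnP (p %/ C) (size cs); last first.
    by rewrite /inst ifF // ltnNge ht.
  have [a [ei _ e]] := instP _ ht; rewrite ei /cur /= e eqxx /=.
  by apply/eqP; apply: column_step.
have [pj|pj] := ltnP (p %% C).+1 C; last first.
  apply/orP; left; rewrite /f /first /=.
  have -> : p + 1 = (p %/ C).+1 * C by rewrite {1}(divn_eq p C); have := ltn_pmod p C0; lia.
  by rewrite modnMl.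
have e1 : (p + 1) %/ C = p %/ C.
  by rewrite {1}(divn_eq p C) -addnA addn1 divnMDl // (divn_small pj) addn0.
have e2 : (p + 1) %% C = (p %% C).+1.
  by rewrite {1}(divn_eq p C) -addnA addn1 modnMDl (modn_small pj).
by rewrite /f e1 e2 /act /prev /cur /next /= !eqxx.
Qed.
End Tableau.

(** * The reduction as a program *)

Section TapeNames.
Variables k n : nat.

Definition base_index : Type := (bool * 'I_k.+1)%type.

(* [TD] marks the offsets between two cells, [TI] and [TV] list the cells, [TF]
   is a flag, [TS] holds the state of the simulated enumerator, the [TB] are
   loop counters, and the [TM] are the tapes of the enumerator. *)
Inductive tname := TD | TI | TV | TF | TS | TB of base_index | TM of 'I_n.+1.

Definition tname_code (t : tname) : ('I_5 + (base_index + 'I_n.+1))%type :=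
  match t with
  | TD => inl (inord 0) | TI => inl (inord 1) | TV => inl (inord 2)
  | TF => inl (inord 3) | TS => inl (inord 4)
  | TB i => inr (inl i) | TM i => inr (inr i)
  end.
Definition tname_decode (x : ('I_5 + (base_index + 'I_n.+1))%type) : tname :=
  match x with
  | inl i => match val i with 0 => TD | 1 => TI | 2 => TV | 3 => TF | _ => TS end
  | inr (inl i) => TB i
  | inr (inr i) => TM i
  end.
Lemma tname_codeK : cancel tname_code tname_decode.
Proof. by case=> //=; rewrite inordK. Qed.
HB.instance Definition _ := Finite.copy tname (can_type tname_codeK).
End TapeNames.
Arguments TD {k n}.
Arguments TI {k n}.
Arguments TV {k n}.
Arguments TF {k n}.
Arguments TS {k n}.
Arguments TB {k n}.
Arguments TM {k n}.

Section Reduction.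
Variables (M : enumerator) (k : nat).

Definition alphabet : finType :=
  (option (bool * bool) + (bool * option (option bool) * bool) + state M + aux M)%type.
Local Notation sym := (symbol alphabet).
Local Notation tn := (tname k (tapes M)).
Local Notation mem := (memory alphabet tn).
Local Notation rdg := (readings alphabet tn).
Local Notation cmd := (cmd alphabet tn).
Local Notation at_ := (atape alphabet).

Definition tick : sym := Some (inl true).
Definition put_mark (m : mark) : sym :=
  match m with
  | MZero => Some (inr (inl (inl (inl None))))
  | MOff s o => Some (inr (inl (inl (inl (Some (s, o))))))
  | MNone => None
  end.
Definition get_mark (s : sym) : mark :=
  match s with
  | Some (inr (inl (inl (inl None)))) => MZero
  | Some (inr (inl (inl (inl (Some (s, o)))))) => MOff s o
  | _ => MNone
  end.
Definition put_info (i : cell_info) : sym := Some (inr (inl (inl (inr i)))).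
Definition get_info (s : sym) : cell_info :=
  if s is Some (inr (inl (inl (inr i)))) then i else (false, None, false).
Definition put_state (q : state M) : sym := Some (inr (inl (inr q))).
Definition get_state (s : sym) : option (state M) :=
  if s is Some (inr (inl (inr q))) then Some q else None.
Definition put_sym (s : symbol (aux M)) : sym :=
  match s with
  | None => None | Some (inl b) => Some (inl b) | Some (inr a) => Some (inr (inr a))
  end.
Definition get_sym (s : sym) : symbol (aux M) :=
  match s with
  | Some (inl b) => Some (inl b) | Some (inr (inr a)) => Some (inr a) | _ => None
  end.

Lemma put_markK m : get_mark (put_mark m) = m. Proof. by case: m. Qed.
Lemma put_symK s : get_sym (put_sym s) = s. Proof. by case: s => [[]|]. Qed.

Definition get_bit (s : sym) : option bool := if s is Some (inl b) then Some b else None.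

(* The working tapes of the reduction; [uO] is the input tape of the enumerator. *)
Record utapes := U { uX : at_; uD : at_; uI : at_; uV : at_; uF : at_; uO : at_ }.

Definition pk (u : utapes) (dB : base_index k -> at_) : mem := fun t =>
  match t with
  | None => uX u
  | Some TD => uD u | Some TI => uI u | Some TV => uV u | Some TF => uF u
  | Some TS => ablank _
  | Some (TB i) => dB i
  | Some (TM i) => if i == ord0 then uO u else ablank _
  end.

Definition nonblank (t : option tn) (r : rdg) : bool := isSome (r t).

Definition skip : cmd := Act (fun r t => (r t, Stay)).

Lemma exec_skip s : execb skip s 1 s.
Proof. by apply: execb_act; apply: upd_same. Qed.

Ltac mem_ext :=
  apply: functional_extensionality => -[[ | | | | | ? | ?]|]; rewrite /upd /rd /=;
  rewrite ?awrite_same //.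

(** * Nested loops over unary counters *)

Section BaseLoops.
Variable m : nat.
Local Notation base := (m + 2)%N.

Definition base_content (n : nat) (z : int) : sym :=
  if (0 <= z)%R && (z < Posz n)%R then tick else None.
Definition base_at (h : int) : at_ := (base_content base, h).
Definition home : at_ := base_at (Posz m + 1)%R.

Definition setB (dB : base_index k -> at_) i a : base_index k -> at_ :=
  fun i' => if i' == i then a else dB i'.

Definition moveB i (mv : Defs.move) : cmd :=
  Act (fun r t => (r t, if t == Some (TB i) then mv else Stay)).

Lemma exec_moveB i mv u dB h :
  execb (moveB i mv) (pk u (setB dB i (base_at h))) 1
        (pk u (setB dB i (base_at (h + dir mv)%R))).
Proof.
apply: execb_act; apply: functional_extensionality => -[t|]; last exact: awrite_same.
rewrite /upd /=; case: (eqVneq (Some t) (Some (TB i))) => [[->]|ne].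
  rewrite /rd /= /setB eqxx /ashift /awrite /aread /=; congr pair.
  by apply: functional_extensionality => z; case: eqP => [->|].
have -> : ashift Stay (awrite (rd (pk u (setB dB i (base_at h))) (Some t))
   (pk u (setB dB i (base_at h)) (Some t))) = pk u (setB dB i (base_at h)) (Some t).
  exact: awrite_same.
case: t ne => //= i' ne; rewrite /setB; case: eqP => // e.
by rewrite e eqxx in ne.
Qed.

Lemma nonblankB i u dB h :
  nonblank (Some (TB i)) (rd (pk u (setB dB i (base_at h)))) =
  (0 <= h)%R && (h < Posz base%N)%R.
Proof. by rewrite /nonblank /rd /= /setB eqxx /aread /= /base_content; case: andP. Qed.

(** One pass of [c] per tick of the counter, from right to left. The head is then brought back to
    the last tick, so that the loop can be nested. *)
Definition loop i (c : cmd) : cmd :=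
  Seq (While (nonblank (Some (TB i))) (Seq c (moveB i MoveLeft)))
  (Seq (moveB i MoveRight)
  (Seq (While (nonblank (Some (TB i))) (moveB i MoveRight)) (moveB i MoveLeft))).

Definition loop_time n := ((base * (n + 1).+1).+1 + (1 + ((base * 2).+1 + 1))).

Lemma setB_same dB i a : dB i = a -> setB dB i a = dB.
Proof. by move=> <-; apply: functional_extensionality => j; rewrite /setB; case: eqP => [->|]. Qed.

(** [g q] gives the tapes after [q] executions of the innermost command, and [W] is the number of
    those made by one pass of the body, a power of [base] in nested loops. *)
Lemma exec_loop_base i c (g : nat -> utapes) dB n W q0 : dB i = home ->
  (forall j, j < base ->
     let d := setB dB i (base_at (Posz m + 1 - Posz j)%R) in
     execb c (pk (g (q0 + j * W)) d) n (pk (g (q0 + j.+1 * W)) d)) ->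
  execb (loop i c) (pk (g q0) dB) (loop_time n) (pk (g (q0 + base * W)) dB).
Proof.
move=> di hc; rewrite -{1 2}(setB_same di) /home.
apply: (@execb_seq _ _ _ _ _ _ (pk (g (q0 + base * W)) (setB dB i (base_at (-1)%R)))).
  pose st j := pk (g (q0 + (base - j) * W)) (setB dB i (base_at (Posz j - 1)%R)).
  have -> : pk (g q0) (setB dB i (base_at (Posz m + 1)%R)) = st base.
    by rewrite /st subnn addn0; congr (pk _ (setB _ _ (base_at _))); lia.
  have -> : pk (g (q0 + base * W)) (setB dB i (base_at (-1)%R)) = st 0.
    by rewrite /st subn0; congr (pk _ (setB _ _ (base_at _))); lia.
  apply: (@execb_while _ _ _ _ st) => [j hj|].
    rewrite /st nonblankB; split; first by lia.
    apply: execb_seq.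
      have := hc (base - j.+1) ltac:(lia); rewrite /=.
      have -> : (base - j.+1).+1 = base - j by lia.
      have -> : (Posz m + 1 - Posz (base - j.+1)%N = Posz j.+1 - 1)%R by lia.
      exact.
    have -> : (Posz j - 1 = Posz j.+1 - 1 + dir MoveLeft)%R by rewrite /=; lia.
    exact: exec_moveB.
  by rewrite /st nonblankB; lia.
apply: execb_seq; first exact: exec_moveB.
apply: (@execb_seq _ _ _ _ _ _ (pk (g (q0 + base * W)) (setB dB i (base_at (Posz base))))).
  pose st j := pk (g (q0 + base * W)) (setB dB i (base_at (Posz base%N - Posz j)%R)).
  have e0 : pk (g (q0 + base * W)) (setB dB i (base_at (-1 + dir MoveRight)%R)) = st base.
    by rewrite /st; congr (pk _ (setB _ _ (base_at _))); rewrite /=; lia.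
  rewrite e0.
  have -> : pk (g (q0 + base * W)) (setB dB i (base_at base)) = st 0.
    by rewrite /st; congr (pk _ (setB _ _ (base_at _))); lia.
  apply: (@execb_while _ _ _ _ st) => [j hj|].
    rewrite /st nonblankB; split; first by lia.
    have -> : (Posz base%N - Posz j = Posz base%N - Posz j.+1 + dir MoveRight)%R by rewrite /=; lia.
    exact: exec_moveB.
  by rewrite /st nonblankB; lia.
have -> : (Posz m + 1 = Posz base%N + dir MoveLeft)%R by rewrite /=; lia.
exact: exec_moveB.
Qed.

Fixpoint nest (s : seq (base_index k)) (c : cmd) : cmd :=
  if s is i :: s' then loop i (nest s' c) else c.

Fixpoint nest_time (l n : nat) : nat :=
  if l is l'.+1 then loop_time (nest_time l' n) else n.

Lemma exec_nest s c (g : nat -> utapes) n dB q0 : uniq s ->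
  (forall i, i \in s -> dB i = home) ->
  (forall dB' q, (forall i, i \notin s -> dB' i = dB i) -> q < base ^ size s ->
     execb c (pk (g (q0 + q)) dB') n (pk (g (q0 + q).+1) dB')) ->
  execb (nest s c) (pk (g q0) dB) (nest_time (size s) n) (pk (g (q0 + base ^ size s)) dB).
Proof.
elim: s dB q0 => [|i s IH] dB q0 /=.
  by move=> _ _ h; have := h dB 0 (fun _ _ => erefl) isT; rewrite addn0 addn1.
move=> /andP[ni us] hd hc; rewrite expnS; apply: exec_loop_base => [|j hj d].
  by apply: hd; rewrite mem_head.
have -> : q0 + j.+1 * base ^ size s = q0 + j * base ^ size s + base ^ size s by lia.
apply: IH => // [i' hi'|dB' q hd' hq].
  rewrite /d /setB; case: eqP => [e|_]; first by rewrite -e hi' in ni.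
  by apply: hd; rewrite inE hi' orbT.
rewrite -addnA; apply: hc => [i'|].
  by rewrite inE negb_or => /andP[n1 n2]; rewrite hd' // /d /setB (negbTE n1).
rewrite expnS; apply: (@leq_trans (j.+1 * base ^ size s)); last by rewrite leq_mul2r hj orbT.
by rewrite mulSn addnC ltn_add2r.
Qed.
End BaseLoops.

Local Notation "c ;; d" := (Seq c d) (at level 85, right associativity).

(** * Preparing the lists of cells and the tape of offsets *)

Section Preparation.
Variable x : seq bool.
Local Notation m := (size x).
Local Notation base := (size x + 2)%N.
Definition width := base ^ k.+1.
Definition height := base ^ k.
Local Notation num_cells := (last_cell width height).+1.

(** One counter fewer than [cols], so that the width is [base] times the height. The boolean keeps
    the two families apart, as column loops run inside row loops. *)
Definition rows : seq (base_index k) := [seq (true, i) | i <- behead (enum 'I_k.+1)].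
Definition cols : seq (base_index k) := [seq (false, i) | i <- enum 'I_k.+1].

Lemma size_rows : size rows = k.
Proof. by rewrite size_map size_behead size_enum_ord. Qed.
Lemma size_cols : size cols = k.+1.
Proof. by rewrite size_map size_enum_ord. Qed.
Lemma uniq_rows : uniq rows.
Proof.
rewrite map_inj_uniq; last by move=> i j [].
by have := enum_uniq 'I_k.+1; case: (enum _) => //= i s /andP[].
Qed.
Lemma uniq_cols : uniq cols.
Proof. by rewrite map_inj_uniq ?enum_uniq // => i j []. Qed.
Lemma cols_rows i : i \in cols -> i \notin rows.
Proof. by move=> /mapP[j _ ->]; apply/mapP => -[]. Qed.

Definition flag (b : bool) : at_ := (fun z => if (z == 0%R) && b then tick else None, 0%R).
Definition cells (q : nat) (z : int) : sym :=
  if (0 <= z)%R && (z < Posz q)%R then put_info (info_at x width height `|z|%N) else None.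
(** [b1] and [b2] tell whether the marks at [width] and at [- width] have been written yet. *)
Definition offsets (b1 b2 : bool) (z : int) : sym :=
  if z == 0%R then put_mark MZero
  else if z == 1%R then put_mark (MOff true false)
  else if z == (-1)%R then put_mark (MOff false false)
  else if b1 && (z == Posz width) then put_mark (MOff true true)
  else if b2 && (z == (- Posz width)%R) then put_mark (MOff false true)
  else None.

Lemma offsetsE z : offsets true true z = put_mark (mark_at width z).
Proof. by rewrite /offsets /mark_at /=; do !case: eqP. Qed.

Lemma base_step j : ashift MoveRight (awrite tick (base_content j, Posz j)) =
  (base_content j.+1, Posz j.+1).
Proof.
rewrite /ashift /awrite /=; congr pair; last by lia.
apply: functional_extensionality => z; rewrite /base_content; case: eqP => [->|ne].
  by rewrite ifT //; lia.
by have -> : (z < Posz j.+1)%R = (z < Posz j)%R by lia.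
Qed.

Lemma base_final j : ashift Stay (awrite tick (base_content j, Posz j)) =
  (base_content j.+1, Posz j).
Proof.
have := base_step j; rewrite /ashift /awrite /= => -[-> _].
by rewrite GRing.addr0.
Qed.

Lemma cells_step q : ashift MoveRight
    (awrite (put_info (info_at x width height q)) (cells q, Posz q)) = (cells q.+1, Posz q.+1).
Proof.
rewrite /ashift /awrite /=; congr pair; last by lia.
apply: functional_extensionality => z; rewrite /cells; case: eqP => [->|ne].
  by rewrite ifT //; lia.
by have -> : (z < Posz q.+1)%R = (z < Posz q)%R by lia.
Qed.

Lemma cells_final q : ashift Stay
    (awrite (put_info (info_at x width height q)) (cells q, Posz q)) = (cells q.+1, Posz q).
Proof.
have := cells_step q; rewrite /ashift /awrite /= => -[-> _].
by rewrite GRing.addr0.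
Qed.

Lemma flag_set b : ashift Stay (awrite tick (flag b)) = flag true.
Proof.
rewrite /ashift /awrite /flag /=; congr pair.
by apply: functional_extensionality => z; rewrite andbT; case: eqP.
Qed.

Lemma flag_clear b : ashift Stay (awrite None (flag b)) = flag false.
Proof.
rewrite /ashift /awrite /flag /=; congr pair.
by apply: functional_extensionality => z; rewrite andbF; case: eqP.
Qed.

Lemma move_only mv (f : int -> sym) h : ashift mv (awrite (aread (f, h)) (f, h)) = (f, h + dir mv)%R.
Proof.
rewrite /ashift /awrite /aread /=; congr pair.
by apply: functional_extensionality => z; case: eqP => [->|].
Qed.

Definition step_base mv : cmd :=
  Act (fun r t => if t is Some (TB _) then (tick, mv) else (r t, Stay)).
Definition copy_base : cmd :=
  Act (fun r t => match t with
    | None => (r t, MoveRight) | Some (TB _) => (tick, MoveRight) | _ => (r t, Stay) end).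
Definition moveX mv : cmd := Act (fun r t => (r t, if t is None then mv else Stay)).
Definition moveD mv : cmd := Act (fun r t => (r t, if t is Some TD then mv else Stay)).
Definition markD d mv : cmd :=
  Act (fun r t => if t is Some TD then (put_mark d, mv) else (r t, Stay)).
Definition raise_flag : cmd :=
  Act (fun r t => if t is Some TF then (tick, Stay) else (r t, Stay)).
Definition first_row_cell : cmd :=
  Act (fun r t => match t with
    | Some TI | Some TV =>
        (put_info (isSome (r (Some TF)), Some (get_bit (r None)), false), MoveRight)
    | None | Some TD => (r t, MoveRight)
    | Some TF => (None, Stay)
    | _ => (r t, Stay) end).
Definition later_cell : cmd :=
  Act (fun r t => match t with
    | Some TI | Some TV => (put_info (isSome (r (Some TF)), None, false), MoveRight)
    | Some TF => (None, Stay)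
    | _ => (r t, Stay) end).
Definition final_cell : cmd :=
  Act (fun r t => match t with
    | Some TI | Some TV => (put_info (true, None, true), Stay)
    | _ => (r t, Stay) end).

Definition mark_origin : cmd :=
  markD MZero MoveRight ;; markD (MOff true false) MoveLeft ;;
  moveD MoveLeft ;; markD (MOff false false) MoveRight.

(** The input length is copied as ticks to all counters, and two more ticks make it [m + 2]. The
    heads of [TD] and of the input advance with the first row; [TD] thereby reaches offset [width],
    and later [- width] by two backward sweeps. *)
Definition prepare : cmd :=
  While (nonblank None) copy_base ;;
  step_base MoveRight ;; step_base Stay ;;
  moveX MoveLeft ;; While (nonblank None) (moveX MoveLeft) ;; moveX MoveRight ;;
  mark_origin ;; raise_flag ;; nest cols first_row_cell ;;
  markD (MOff true true) Stay ;;
  nest rows (raise_flag ;; nest cols later_cell) ;;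
  final_cell ;;
  nest cols (moveD MoveLeft) ;; nest cols (moveD MoveLeft) ;;
  markD (MOff false true) Stay ;; nest cols (moveD MoveRight).

Definition X0 h : at_ := (word_at _ x, h).

Definition prep (hX hD : int) b1 b2 q fl : utapes :=
  U (X0 hX) (offsets b1 b2, hD) (cells q, Posz q) (cells q, Posz q) (flag fl) (ablank _).

Definition copied (hX : int) (n : nat) : mem :=
  pk (U (X0 hX) (ablank _) (ablank _) (ablank _) (ablank _) (ablank _))
     (fun=> (base_content n, Posz n)).

Lemma init_copied : init_memory alphabet tn x = copied 0%R 0.
Proof.
apply: functional_extensionality => -[[ | | | | | ? | i]|] //=.
  congr pair; apply: functional_extensionality => z; rewrite /base_content.
  by rewrite ifF //; lia.
by case: eqP.
Qed.

Lemma nonblankX hX (u : utapes) dB : uX u = X0 hX ->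
  nonblank None (rd (pk u dB)) = (0 <= hX)%R && (hX < Posz m)%R.
Proof.
rewrite /nonblank /rd /= => -> ; rewrite /aread /X0 /= /word_at.
case: hX => // n; have [h|h] := ltnP n m.
  by rewrite (nth_map false) //=; lia.
by rewrite nth_default ?size_map //=; lia.
Qed.

Definition prepare_time : nat :=
  let nt := nest_time m k.+1 1 in
  ((m * 2).+1 + (1 + (1 + (1 + ((m * 2).+1 + (1 + (4 + (1 + (nt + (1 +
   (nest_time m k (1 + nt) + (1 + (nt + (nt + (1 + nt))))))))))))))).

Definition scanned (hX hD : int) dc : mem :=
  pk (U (X0 hX) (dc, hD) (ablank _) (ablank _) (ablank _) (ablank _)) (fun=> home m).

Lemma exec_copy : execb (While (nonblank None) copy_base) (copied 0%R 0) (m * 2).+1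
  (copied (Posz m) m).
Proof.
pose st j := copied (Posz (m - j)) (m - j).
have -> : copied 0%R 0 = st m by rewrite /st subnn.
have -> : copied (Posz m) m = st 0 by rewrite /st subn0.
apply: (@execb_while _ _ _ _ st) => [j hj|].
  rewrite /st (nonblankX (hX := Posz (m - j.+1))) //; split; first by lia.
  have -> : m - j = (m - j.+1).+1 by lia.
  apply: execb_act; mem_ext; first exact: base_step.
  by rewrite move_only /=; congr pair; lia.
by rewrite /st (nonblankX (hX := Posz (m - 0))) // ; lia.
Qed.

Lemma exec_step_base hX n : execb (step_base MoveRight) (copied hX n) 1 (copied hX n.+1).
Proof. by apply: execb_act; mem_ext; apply: base_step. Qed.

Lemma exec_step_base_last hX : execb (step_base Stay) (copied hX m.+1) 1
  (scanned hX 0%R (fun=> None)).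
Proof.
apply: execb_act; mem_ext; rewrite base_final /home /base_at.
by congr (base_content _, _); lia.
Qed.

Lemma exec_moveX mv hX hD dc :
  execb (moveX mv) (scanned hX hD dc) 1 (scanned (hX + dir mv)%R hD dc).
Proof. by apply: execb_act; mem_ext; apply: move_only. Qed.

Lemma exec_rewindX dc : execb (While (nonblank None) (moveX MoveLeft))
  (scanned (Posz m - 1)%R 0%R dc) (m * 2).+1 (scanned (-1)%R 0%R dc).
Proof.
pose st j := scanned (Posz j - 1)%R 0%R dc.
apply: (@execb_while _ _ _ _ st) => [j hj|].
  rewrite /st (nonblankX (hX := (Posz j.+1 - 1)%R)) //; split; first by lia.
  have -> : (Posz j - 1 = Posz j.+1 - 1 + dir MoveLeft)%R by rewrite /=; lia.
  exact: exec_moveX.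
by rewrite /st (nonblankX (hX := (Posz 0 - 1)%R)) //; lia.
Qed.

Lemma exec_markD d mv u dB (f f' : int -> sym) h : uD u = (f, h) ->
  (fun z => if z == h then put_mark d else f z) = f' ->
  execb (markD d mv) (pk u dB) 1
    (pk (U (uX u) (f', h + dir mv)%R (uI u) (uV u) (uF u) (uO u)) dB).
Proof. by move=> eD ef; apply: execb_act; mem_ext; rewrite eD /ashift /awrite /= ef. Qed.

Lemma exec_moveD mv u dB (f : int -> sym) h : uD u = (f, h) ->
  execb (moveD mv) (pk u dB) 1
    (pk (U (uX u) (f, h + dir mv)%R (uI u) (uV u) (uF u) (uO u)) dB).
Proof. by move=> eD; apply: execb_act; mem_ext; rewrite eD move_only. Qed.

Lemma exec_marks :
  execb mark_origin (scanned 0%R 0%R (fun=> None)) 4 (pk (prep 0%R 0%R false false 0 false) (fun=> home m)).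
Proof.
have -> : pk (prep 0%R 0%R false false 0 false) (fun=> home m) =
          scanned 0%R 0%R (offsets false false).
  apply: functional_extensionality => -[[ | | | | | ? | i]|] //=; congr pair;
  by apply: functional_extensionality => z; rewrite /cells ?andbF //; rewrite ifF //; lia.
apply: (execb_seq (n1 := 1) (n2 := 3)); first by apply: exec_markD.
apply: (execb_seq (n1 := 1) (n2 := 2)); first by apply: exec_markD.
apply: (execb_seq (n1 := 1) (n2 := 1)); first by apply: exec_moveD.
rewrite /scanned /=.
rewrite [X in execb _ _ _ X](_ : _ = pk (U (X0 0) (offsets false false, (-1 + dir MoveRight))%R
   (ablank _) (ablank _) (ablank _) (ablank _)) (fun=> home m)) //.
apply: exec_markD => //=; apply: functional_extensionality => z; rewrite /offsets /=.
by do !case: eqP => //=; lia.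
Qed.

Lemma exec_raise_flag hX hD b1 b2 q fl dB :
  execb raise_flag (pk (prep hX hD b1 b2 q fl) dB) 1 (pk (prep hX hD b1 b2 q true) dB).
Proof. by apply: execb_act; mem_ext; apply: flag_set. Qed.

Lemma exec_later hX hD b1 b2 q dB : width <= q < last_cell width height ->
  execb later_cell (pk (prep hX hD b1 b2 q (q %% width == 0)) dB) 1
                   (pk (prep hX hD b1 b2 q.+1 false) dB).
Proof.
move=> /andP[hq1 hq2]; apply: execb_act; mem_ext; rewrite ?flag_clear //;
rewrite -cells_step; congr (ashift _ (awrite (put_info _) _));
by rewrite /info_at ltnNge hq1 (ltn_eqF hq2) /aread /= ; case: eqP.
Qed.

Lemma exec_first q dB b1 b2 : q < width ->
  execb first_row_cell (pk (prep (Posz q) (Posz q) b1 b2 q (q == 0)) dB) 1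
                   (pk (prep (Posz q.+1) (Posz q.+1) b1 b2 q.+1 false) dB).
Proof.
move=> hq; have hl : (q == last_cell width height) = false.
  by apply: ltn_eqF; apply: leq_trans hq _; rewrite /last_cell mulSn leq_addr.
apply: execb_act; mem_ext; rewrite ?flag_clear ?move_only //=.
- by congr pair; lia.
- rewrite -cells_step; congr (ashift _ (awrite (put_info _) _)).
  rewrite /info_at hq hl modn_small // /aread /= /word_at; congr (_, Some _, _); first by case: eqP.
  have [h|h] := ltnP q m; first by rewrite !(nth_map false).
  by rewrite !nth_default ?size_map.
- rewrite -cells_step; congr (ashift _ (awrite (put_info _) _)).
  rewrite /info_at hq hl modn_small // /aread /= /word_at; congr (_, Some _, _); first by case: eqP.
  have [h|h] := ltnP q m; first by rewrite !(nth_map false).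
  by rewrite !nth_default ?size_map.
- by congr pair; lia.
Qed.

Lemma exec_row hX hD b1 b2 dB t : t.+1 < height.+1 ->
  (forall i, i \in cols -> dB i = home m) ->
  execb (raise_flag ;; nest cols later_cell) (pk (prep hX hD b1 b2 (t.+1 * width) false) dB)
    (1 + nest_time m k.+1 1) (pk (prep hX hD b1 b2 (t.+2 * width) false) dB).
Proof.
move=> ht hd; apply: execb_seq; first exact: exec_raise_flag.
pose g j := prep hX hD b1 b2 (t.+1 * width + j) (j == 0).
have W0 : 0 < width by rewrite expn_gt0 addn2.
have -> : prep hX hD b1 b2 (t.+1 * width) true = g 0 by rewrite /g addn0.
have -> : prep hX hD b1 b2 (t.+2 * width) false = g (0 + base ^ size cols).
  by rewrite /g size_cols add0n -/width (gtn_eqF W0) mulSn addnC.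
rewrite -{1}size_cols; apply: exec_nest => //; first exact: uniq_cols.
move=> dB' q _; rewrite size_cols -/width add0n => hq.
rewrite /g addnS.
have -> : (q == 0) = ((t.+1 * width + q) %% width == 0) by rewrite modnMDl modn_small.
apply: exec_later; rewrite /last_cell; apply/andP; split.
  by rewrite mulSn -addnA leq_addr.
apply: (@leq_trans (t.+2 * width)); last by rewrite leq_mul2r ht orbT.
by rewrite [t.+2 * _]mulSn addnC ltn_add2r.
Qed.

Lemma exec_nest_moveD mv u dB (f : int -> sym) h : uD u = (f, h) ->
  (forall i, i \in cols -> dB i = home m) ->
  execb (nest cols (moveD mv)) (pk u dB) (nest_time m k.+1 1)
    (pk (U (uX u) (f, h + Posz width * dir mv)%R (uI u) (uV u) (uF u) (uO u)) dB).
Proof.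
move=> eD hd.
pose g (j : nat) := U (uX u) (f, h + Posz j * dir mv)%R (uI u) (uV u) (uF u) (uO u).
have -> : pk u dB = pk (g 0) dB.
  apply: functional_extensionality => -[[ | | | | | ? | ?]|] //=; rewrite eD.
  by congr pair; lia.
have -> : width = 0 + base ^ size cols by rewrite size_cols.
rewrite -{1}size_cols; apply: exec_nest => //; first exact: uniq_cols.
move=> dB' q _ _; rewrite {2}/g.
have -> : (h + Posz (0 + q).+1 * dir mv = h + Posz (0 + q) * dir mv + dir mv)%R.
  by rewrite -addn1 PoszD GRing.mulrDl GRing.mul1r GRing.addrA.
exact: exec_moveD.
Qed.

Definition prepared : utapes :=
  U (X0 (Posz width)) (offsets true true, 0%R)
    (cells num_cells, Posz (last_cell width height))
    (cells num_cells, Posz (last_cell width height)) (flag false) (ablank _).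

Lemma exec_prepare :
  execb prepare (init_memory alphabet tn x) prepare_time (pk prepared (fun=> home m)).
Proof.
have W1 : 1 < width.
  have : 0 < base ^ k by rewrite expn_gt0 addn2.
  by rewrite /width expnS; move: (base ^ k) => b; nia.
rewrite init_copied /prepare /prepare_time.
apply: execb_seq; first exact: exec_copy.
apply: execb_seq; first exact: exec_step_base.
apply: execb_seq; first exact: exec_step_base_last.
apply: execb_seq; first exact: exec_moveX.
apply: execb_seq; first exact: exec_rewindX.
apply: execb_seq; first exact: exec_moveX.
have hd : forall i : base_index k, i \in cols -> home m = home m by [].
apply: execb_seq; first exact: exec_marks.
apply: execb_seq; first exact: exec_raise_flag.
apply: (execb_seq (s2 := pk (prep (Posz width) (Posz width) false false width false) (fun=> home m))).
  pose g j := prep (Posz j) (Posz j) false false j (j == 0).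
  have -> : prep (Posz width) (Posz width) false false width false = g (0 + base ^ size cols).
    by rewrite /g size_cols add0n -/width; congr prep; lia.
  rewrite -{1}size_cols; apply: (exec_nest (g := g)) => //; first exact: uniq_cols.
  by move=> dB' q _; rewrite size_cols -/width add0n => hq; apply: exec_first.
apply: (execb_seq (s2 := pk (prep (Posz width) (Posz width) true false width false) (fun=> home m))).
  have -> : prep (Posz width) (Posz width) true false width false =
    U (X0 (Posz width)) (offsets true false, Posz width + dir Stay)%R (cells width, Posz width)
      (cells width, Posz width) (flag false) (ablank _).
    by congr (U _ (_, _)); rewrite /=; lia.
  apply: (@exec_markD (MOff true true) Stay (prep (Posz width) (Posz width) false false width false)) => //=.
  by apply: functional_extensionality => z; rewrite /offsets /=; do !case: eqP => //=; lia.
apply: (execb_seq (s2 := pk (prep (Posz width) (Posz width) true false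
    (last_cell width height) false) (fun=> home m))).
  pose g t := prep (Posz width) (Posz width) true false (t.+1 * width) false.
  have -> : prep (Posz width) (Posz width) true false width false = g 0 by rewrite /g mul1n.
  have -> : prep (Posz width) (Posz width) true false (last_cell width height) false =
    g (0 + base ^ size rows) by rewrite /g size_rows.
  rewrite -[X in nest_time _ X (1 + _)]size_rows; apply: exec_nest => //; first exact: uniq_rows.
  move=> dB' t hd'; rewrite size_rows -/height add0n => ht; apply: exec_row => // i hi.
  by apply: hd'; apply: cols_rows.
apply: (execb_seq (s2 := pk (U (X0 (Posz width)) (offsets true false, Posz width)
    (cells num_cells, Posz (last_cell width height))
    (cells num_cells, Posz (last_cell width height)) (flag false) (ablank _)) (fun=> home m))).
  have e : (true, None, true) = info_at x width height (last_cell width height).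
    rewrite /info_at eqxx {1}/last_cell modnMl eqxx ltnNge /last_cell mulSn leq_addr //.
  by apply: execb_act; mem_ext; rewrite e; apply: cells_final.
apply: execb_seq; first exact: exec_nest_moveD.
apply: execb_seq; first exact: exec_nest_moveD.
apply: execb_seq.
  apply: exec_markD => /=; first by [].
  reflexivity.
have -> : prepared = U (X0 (Posz width)) (offsets true true,
   - Posz width + Posz width * dir MoveRight)%R (cells num_cells, Posz (last_cell width height))
    (cells num_cells, Posz (last_cell width height)) (flag false) (ablank _).
  by congr (U _ (_, _)); rewrite /=; lia.
have -> : (fun z : int => if z == (Posz width + Posz width * dir MoveLeft + Posz width * dir MoveLeft)%R
   then put_mark (MOff false true) else offsets true false z) = offsets true true.
  by apply: functional_extensionality => z; rewrite /offsets /=; do !case: eqP => //=; lia.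
have -> : (Posz width + Posz width * dir MoveLeft + Posz width * dir MoveLeft + dir Stay = - Posz width)%R.
  by rewrite /=; lia.
exact: exec_nest_moveD.
Qed.
End Preparation.

(** * Writing the encoded instance *)

Section Writing.
Variables (x : seq bool) (L : finType).
Variables (allow : cell_info -> L -> bool) (R : bool -> rel L).
Local Notation last_c := (last_cell (width x) (height x)).
Local Notation num_cells := last_c.+1.
Local Notation info := (info_at x (width x) (height x)).

(* The word [w] starts just after the head. *)
Definition output_tape (w : seq bool) : at_ :=
  (fun z => word_at _ w (z + Posz (size w) - 1)%R, - Posz (size w))%R.

Definition writing (hI hV : int) (w : seq bool) : mem :=
  pk (U (X0 x (Posz (width x))) (offsets x true true, hV - hI)%R
        (cells x num_cells, hI) (cells x num_cells, hV) (flag false) (output_tape w))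
     (fun=> home (size x)).

Lemma prepared_writing :
  pk (prepared x) (fun=> home (size x)) = writing (Posz last_c) (Posz last_c) [::].
Proof.
apply: functional_extensionality => -[[ | | | | | ? | i]|] //=.
  by rewrite GRing.subrr.
case: eqP => // _; rewrite /output_tape /ablank /=; congr pair.
by apply: functional_extensionality => z; rewrite /word_at; case: (_ + _ - 1)%R => [[]|].
Qed.

Definition push (b : rdg -> bool) : cmd :=
  Act (fun r t => if t is Some (TM i) then
                    if i == ord0 then (Some (inl (b r)), MoveLeft) else (r t, Stay)
                  else (r t, Stay)).

Lemma exec_push b hI hV w :
  execb (push b) (writing hI hV w) 1 (writing hI hV (b (rd (writing hI hV w)) :: w)).
Proof.
apply: execb_act; mem_ext; case: eqP => _; rewrite ?awrite_same //.
rewrite /ashift /awrite /output_tape /=; congr pair; last by lia.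
apply: functional_extensionality => z; case: eqP => [->|ne].
  by have -> : (- Posz (size w) + (size w).+1 - 1 = 0)%R by lia.
have -> : (z + (size w).+1 - 1 = z + size w - 1 + 1)%R by lia.
have : (z + size w - 1 != -1)%R by lia.
move: (z + size w - 1)%R => [j|[|j]] // _.
by have -> : (Posz j + 1 = Posz j.+1)%R by lia.
Qed.

(** Every move of [TV] or [TI] comes with a move of [TD], whose head thus stays at [hV - hI]. *)
Definition moveV mv : cmd :=
  Act (fun r t => (r t, match t with Some TV | Some TD => mv | _ => Stay end)).
Definition prevI : cmd :=
  Act (fun r t => (r t, match t with Some TI => MoveLeft | Some TD => MoveRight | _ => Stay end)).

Lemma exec_moveV mv hI hV w :
  execb (moveV mv) (writing hI hV w) 1 (writing hI (hV + dir mv)%R w).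
Proof.
by apply: execb_act; mem_ext; rewrite move_only //; congr pair; rewrite GRing.addrAC.
Qed.

Lemma exec_prevI hI hV w : execb prevI (writing hI hV w) 1 (writing (hI - 1)%R hV w).
Proof. by apply: execb_act; mem_ext; rewrite move_only //=; congr pair; lia. Qed.

Lemma nonblankV hI hV w : nonblank (Some TV) (rd (writing hI hV w)) =
  (0 <= hV)%R && (hV < Posz num_cells)%R.
Proof. by rewrite /nonblank /rd /= /aread /= /cells; case: andP. Qed.

Lemma nonblankI hI hV w : nonblank (Some TI) (rd (writing hI hV w)) =
  (0 <= hI)%R && (hI < Posz num_cells)%R.
Proof. by rewrite /nonblank /rd /= /aread /= /cells; case: andP. Qed.

Definition loopV (c : cmd) : cmd :=
  While (nonblank (Some TV)) (c ;; moveV MoveLeft) ;;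
  moveV MoveRight ;; While (nonblank (Some TV)) (moveV MoveRight) ;; moveV MoveLeft.

Definition loopV_time n := (num_cells * (n + 1).+1).+1 + (1 + ((num_cells * 2).+1 + 1)).

Lemma exec_loopV c n hI F w :
  (forall p w, p < num_cells ->
     execb c (writing hI (Posz p) w) n (writing hI (Posz p) (F p ++ w))) ->
  execb (loopV c) (writing hI (Posz last_c) w) (loopV_time n)
    (writing hI (Posz last_c) (flatten [seq F p | p <- iota 0 num_cells] ++ w)).
Proof.
move=> hc; set w' := flatten _ ++ w.
apply: (execb_seq (s2 := writing hI (-1)%R w')).
  pose st j := writing hI (Posz j - 1)%R
    (flatten [seq F p | p <- iota j (num_cells - j)] ++ w).
  have -> : writing hI (Posz last_c) w = st num_cells.
    by rewrite /st subnn /=; congr writing; lia.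
  have -> : writing hI (-1)%R w' = st 0 by rewrite /st subn0; congr writing; lia.
  apply: (@execb_while _ _ _ _ st) => [j hj|].
    rewrite /st nonblankV; split; first by lia.
    have -> : (Posz j.+1 - 1 = Posz j)%R by lia.
    apply: execb_seq; first exact: hc.
    have -> : num_cells - j = (num_cells - j.+1).+1 by lia.
    by rewrite /= -catA; apply: (exec_moveV MoveLeft).
  by rewrite /st nonblankV; lia.
apply: execb_seq; first exact: exec_moveV.
apply: (execb_seq (s2 := writing hI (Posz num_cells) w')).
  pose st j := writing hI (Posz num_cells - Posz j)%R w'.
  have -> : writing hI (-1 + dir MoveRight)%R w' = st num_cells.
    by rewrite /st; congr writing; rewrite /=; lia.
  have -> : writing hI (Posz num_cells) w' = st 0 by rewrite /st; congr writing; lia.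
  apply: (@execb_while _ _ _ _ st) => [j hj|].
    rewrite /st nonblankV; split; first by lia.
    have -> : (Posz num_cells - Posz j = Posz num_cells - Posz j.+1 + dir MoveRight)%R.
      by rewrite /=; lia.
    exact: exec_moveV.
  by rewrite /st nonblankV; lia.
have -> : (Posz last_c = Posz num_cells + dir MoveLeft)%R by rewrite /=; lia.
exact: exec_moveV.
Qed.

(** The tail runs before the head, since [push] extends the word on the left. *)
Fixpoint each (T : Type) (c : T -> cmd) (s : seq T) : cmd :=
  if s is t :: s' then each c s' ;; c t else skip.

Lemma exec_each (T : Type) (c : T -> cmd) (F : T -> seq bool) hI hV n w s :
  (forall t w, execb (c t) (writing hI hV w) n (writing hI hV (F t ++ w))) ->
  execb (each c s) (writing hI hV w) (1 + size s * n)
    (writing hI hV (flatten [seq F t | t <- s] ++ w)).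
Proof.
move=> hc; elim: s => [|t s IH] /=; first exact: exec_skip.
have -> : 1 + (size s).+1 * n = (1 + size s * n) + n by rewrite mulSn; lia.
by rewrite -catA; apply: execb_seq (hc _ _).
Qed.

Local Notation types := (enum {: vtype L}).
Local Notation ntypes := (size types).

(** Written from its end: terminal bits, matrix, separator, and the unary number of vertices
    last. *)
Definition write_encoding : cmd :=
  loopV (each (fun t => push (fun=> is_terminal t)) types) ;;
  While (nonblank (Some TI))
    (each (fun t => loopV (each (fun t' => push (fun r =>
        edge_bit allow cell_border R (get_info (r (Some TI))) (get_info (r (Some TV)))
                 (get_mark (r (Some TD))) t t')) types)) types ;; prevI) ;;
  push (fun=> false) ;;
  loopV (each (fun=> push (fun=> true)) types).

Definition encoding_time : nat :=
  let lt := loopV_time (1 + ntypes * 1) in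
  lt + ((num_cells * ((1 + ntypes * lt) + 1).+1).+1 + (1 + lt)).

Definition row_bits (p : nat) (t : vtype L) : seq bool :=
  flatten [seq flatten [seq [:: link allow cell_border R (width x) info (p, t) (q, t')]
    | t' <- types] | q <- iota 0 num_cells].

Definition encoding : seq bool :=
  flatten [seq flatten [seq [:: true] | t <- types] | q <- iota 0 num_cells] ++ false ::
  flatten [seq flatten [seq row_bits p t | t <- types] | p <- iota 0 num_cells] ++
  flatten [seq flatten [seq [:: is_terminal t] | t <- types] | q <- iota 0 num_cells].

Lemma exec_write_encoding :
  execb write_encoding (writing (Posz last_c) (Posz last_c) [::]) encoding_time
    (writing (-1)%R (Posz last_c) encoding).
Proof.
apply: execb_seq.
  apply: (exec_loopV (F := fun=> flatten [seq [:: is_terminal t] | t <- types])) => p w hp.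
  by apply: exec_each => t w1; apply: exec_push.
set w1 := flatten _ ++ [::].
pose wI j := flatten [seq flatten [seq row_bits p t | t <- types] | p <- iota j (num_cells - j)] ++ w1.
apply: (execb_seq (s2 := writing (-1)%R (Posz last_c) (wI 0))).
  pose st j := writing (Posz j - 1)%R (Posz last_c) (wI j).
  have -> : writing (Posz last_c) (Posz last_c) w1 = st num_cells.
    by rewrite /st /wI subnn /=; congr writing; lia.
  have -> : writing (-1)%R (Posz last_c) (wI 0) = st 0 by rewrite /st; congr writing; lia.
  apply: (@execb_while _ _ _ _ st) => [j hj|].
    rewrite /st nonblankI; split; first by lia.
    have -> : (Posz j.+1 - 1 = Posz j)%R by lia.
    rewrite /wI; have -> : num_cells - j = (num_cells - j.+1).+1 by lia.
    rewrite /= -catA; apply: execb_seq (exec_prevI _ _ _).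
    apply: (exec_each (F := row_bits j)) => t w.
    apply: exec_loopV => q w2 hq; apply: exec_each => t' w3.
    rewrite cat1s.
    set b := link _ _ _ _ _ _ _.
    rewrite (_ : b = edge_bit allow cell_border R
      (get_info (rd (writing j q w3) (Some TI))) (get_info (rd (writing j q w3) (Some TV)))
      (get_mark (rd (writing j q w3) (Some TD))) t t').
      exact: (exec_push (fun r => edge_bit allow cell_border R (get_info (r (Some TI)))
        (get_info (r (Some TV))) (get_mark (r (Some TD))) t t')).
    rewrite /rd /= /aread /= offsetsE put_markK /cells.
    by rewrite !ifT //; lia.
  by rewrite /st nonblankI; lia.
apply: execb_seq; first exact: exec_push.
rewrite /wI subn0 /w1 cats0; apply: (exec_loopV (F := fun=> flatten [seq [:: true] | t <- types])).
by move=> p w hp; apply: exec_each => t w2; apply: exec_push.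
Qed.
End Writing.

(** * Simulating the enumerator up to its first event *)

Definition sim_symbols (r : rdg) : {ffun 'I_(tapes M).+1 -> symbol (aux M)} :=
  [ffun i => get_sym (r (Some (TM i)))].

Definition sim_halted (r : rdg) : bool :=
  if get_state (r (Some TS)) is Some q then nilp (trans q (sim_symbols r)) else true.

Definition sim_emitting (r : rdg) : bool :=
  if get_state (r (Some TS)) is Some q then emitting q else false.

Definition sim_start : cmd :=
  Act (fun r t => match t with
    | Some TS => (put_state (start M), Stay)
    | Some (TM i) => (r t, if i == ord0 then MoveRight else Stay)
    | _ => (r t, Stay) end).

(** The transition table sits in the control of the program, so one action performs one step of [M];
    the loop test doubles the time. *)
Definition sim_step : cmd :=
  Act (fun r t =>
    if get_state (r (Some TS)) is Some q then
      if trans q (sim_symbols r) is a :: _ then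
        match t with
        | Some TS => (put_state a.1, Stay)
        | Some (TM i) => (put_sym (a.2 i).1, (a.2 i).2)
        | _ => (r t, Stay)
        end
      else (r t, Stay)
    else (r t, Stay)).

Definition simulate : cmd :=
  sim_start ;; While (fun r => ~~ sim_halted r && ~~ sim_emitting r) sim_step.

Definition sims (c : config M) (s : mem) : Prop :=
  aread (s (Some TS)) = put_state c.1 /\
  forall i, represents put_sym (c.2 i) (s (Some (TM i))).

Lemma sims_symbols c s : sims c s -> sim_symbols (rd s) = [ffun i => read (c.2 i)].
Proof.
move=> [_ h]; apply/ffunP => i; rewrite !ffunE /rd.
by rewrite -(represents_read (h i)) put_symK.
Qed.

Lemma sims_halted c s : sims c s -> sim_halted (rd s) = halted c.
Proof.
move=> h; rewrite /sim_halted {1}/rd h.1 /= (sims_symbols h).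
by rewrite /halted /nilp size_map.
Qed.

Lemma sims_emitting c s : sims c s -> sim_emitting (rd s) = emitting c.1.
Proof. by move=> h; rewrite /sim_emitting {1}/rd h.1. Qed.

Lemma sims_step c s : sims c s -> ~~ halted c ->
  exists2 s', execb sim_step s 1 s' & sims (head c (successors c)) s'.
Proof.
move=> h nh; eexists; first by apply: execb_act.
have eS : get_state (rd s (Some TS)) = Some c.1 by rewrite /rd h.1.
move: nh; rewrite /halted /successors; case e: trans => [|a l] //= _; split.
  by rewrite /upd eS (sims_symbols h) e /aread /= GRing.addr0 eqxx.
move=> i; rewrite /upd eS (sims_symbols h) e /= ffunE.
by apply: represents_step; [|apply: h.2].
Qed.

Lemma sims_start x w hI hV :
  exists2 s, execb sim_start (writing x hI hV w) 1 s & sims (init M w) s.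
Proof.
eexists; first by apply: execb_act.
split; first by rewrite /upd /aread /= ?eqxx.
move=> i; rewrite /upd /init /= ffunE /rd /=; case: eqP => _.
  rewrite move_only /output_tape /=; split=> j /=; last first.
    rewrite nth_nil; set y := (_ - 1)%R.
    have : (y < 0)%R by rewrite /y; lia.
    by case: y.
  have -> : (- Posz (size w) + 1 + j + size w - 1 = Posz j)%R by lia.
  rewrite /=; have [hj|hj] := ltnP j (size w); first by rewrite !(nth_map false).
  by rewrite !nth_default ?size_map.
by split=> j; rewrite /= ?nth_nil //; case: eqP.
Qed.

Lemma exec_simulate x w hI hV T :
  (forall t, t < T -> ~~ halted (run M w t) && ~~ emitting (run M w t).1) ->
  halted (run M w T) || emitting (run M w T).1 ->
  exists2 s, execb simulate (writing x hI hV w) (1 + (T * 2).+1) s & sims (run M w T) s.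
Proof.
move=> hlt hT; have [s0 e0 h0] := sims_start x w hI hV.
(* The memories along the run are collected into a sequence, which [execb_while] then reads
   backwards. *)
have st t : t <= T -> exists s : nat -> mem,
    [/\ s 0 = s0, forall i, i < t -> execb sim_step (s i) 1 (s i.+1) &
        forall i, i <= t -> sims (run M w i) (s i)].
  elim: t => [_|t IH ht]; first by exists (fun=> s0); split=> // -[].
  have [s [s1 s2 s3]] := IH (ltnW ht).
  have /andP[nh _] := hlt t ht.
  have [s' e' h'] := sims_step (s3 t (leqnn _)) nh.
  exists (fun i => if i <= t then s i else s'); split=> // i.
    rewrite ltnS => hi; rewrite hi; case: (leqP i.+1 t) => hi'; first exact: s2.
    by have -> : i = t by lia.
  case: (leqP i t) => hi hi'; first exact: s3.
  by have -> : i = t.+1 by lia.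
have [s [s1 s2 s3]] := st T (leqnn _).
exists (s T); last exact: s3.
apply: execb_seq; first exact: e0.
have -> : s0 = (fun j => s (T - j)) T by rewrite /= subnn.
have -> : s T = (fun j => s (T - j)) 0 by rewrite /= subn0.
apply: (@execb_while _ _ _ _ (fun j => s (T - j))) => [i hi|].
  have h : T - i.+1 < T by lia.
  have hs := s3 _ (ltnW h); rewrite (sims_halted hs) (sims_emitting hs); split; first exact: hlt.
  have -> : T - i = (T - i.+1).+1 by lia.
  exact: s2.
rewrite subn0; have hs := s3 _ (leqnn T); rewrite (sims_halted hs) (sims_emitting hs).
by rewrite -negb_or hT.
Qed.
End Reduction.

(** * The instance computed by the program *)

(** A proper subgraph has fewer vertices and edges in total, so descending to smaller internal
    Steiner trees ends at a minimal one. *)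
Lemma minimal_internal_steiner_tree_exists (V : finType) (G : graph V) W T :
  internal_steiner_tree G W T -> exists T', minimal_internal_steiner_tree G W T'.
Proof.
have [n] := ubnP (#|vertices T| + #|edges T|); elim: n T => // n IH T hn hT.
case: (classic (exists2 T', proper_subgraph T' T & internal_steiner_tree G W T')).
  move=> [T' /andP[/andP[sV sE] ns] hT']; apply: IH hT'.
  have le1 := subset_leq_card sV; have le2 := subset_leq_card sE.
  suff : #|vertices T'| + #|edges T'| != #|vertices T| + #|edges T| by lia.
  apply/negP => /eqP e; case/negP: ns; apply/andP; split.
    by rewrite (eqP (_ : vertices T' == vertices T)) // eqEcard sV; lia.
  by rewrite (eqP (_ : edges T' == edges T)) // eqEcard sE; lia.
move=> no; exists T; split=> // T' pT' hT'.
by case: no; exists T'.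
Qed.

Section Coding.
Variables (L : finType) (P : nat).
Hypothesis P0 : 0 < P.
Local Notation types := (enum {: vtype L}).

Definition num_types := size types.
Definition num_places := P * num_types.

Lemma num_types_gt0 : 0 < num_types.
Proof. by rewrite /num_types -cardT; apply/card_gt0P; exists VG. Qed.

Lemma num_places_gt0 : 0 < num_places.
Proof. by rewrite muln_gt0 P0 num_types_gt0. Qed.

(** Cells outside, types inside: the order in which the loops of [write_encoding] visit the
    places. *)
Definition decode (i : nat) : place L := (i %/ num_types, nth VG types (i %% num_types)).
Definition vplace (v : 'I_num_places) : place L := decode v.
Definition mkplace (x : place L) : 'I_num_places :=
  insubd (Ordinal num_places_gt0) (x.1 * num_types + index x.2 types).

Lemma vplace_lt v : (vplace v).1 < P.
Proof. by rewrite /= ltn_divLR ?num_types_gt0. Qed.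

Lemma index_type t : index t types < num_types.
Proof. by rewrite /num_types index_mem mem_enum. Qed.

Lemma mkplaceE x : x.1 < P -> mkplace x = x.1 * num_types + index x.2 types :> nat.
Proof.
move=> hx; rewrite val_insubd ifT // /num_places.
apply: (@leq_trans (x.1.+1 * num_types)); last by rewrite leq_mul2r hx orbT.
by rewrite mulSn addnC ltn_add2r index_type.
Qed.

Lemma mkplaceK x : x.1 < P -> vplace (mkplace x) = x.
Proof.
move=> hx; rewrite /vplace mkplaceE // /decode divnMDl ?num_types_gt0 //.
rewrite divn_small ?index_type // addn0 modnMDl modn_small ?index_type //.
by rewrite nth_index ?mem_enum //; case: x {hx}.
Qed.

Lemma vplaceK : cancel vplace mkplace.
Proof.
move=> v; apply: val_inj; rewrite /= mkplaceE ?vplace_lt //=.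
by rewrite index_uniq ?enum_uniq ?ltn_pmod ?num_types_gt0 // -divn_eq.
Qed.

Lemma decode_iota p : map decode (iota 0 (p * num_types)) =
  [seq (q, t) | q <- iota 0 p, t <- types].
Proof.
elim: p => [|p IH] //; rewrite mulSn addnC iotaD map_cat IH add0n.
rewrite -addn1 iotaD allpairs_cat /= cats0; congr cat.
rewrite -[in LHS](addn0 (p * _)) iotaDl -map_comp.
have szL (f : nat -> place L) : size [seq f i | i <- iota 0 num_types] = num_types.
  by rewrite size_map size_iota.
have szR (f : vtype L -> place L) : size (map f types) = num_types by rewrite size_map.
apply: (@eq_from_nth _ (0, VG)) => [|i]; rewrite szL ?szR // => hi.
rewrite (nth_map 0) ?size_iota // nth_iota // add0n (nth_map VG) //=.
by rewrite /decode divnMDl ?num_types_gt0 // divn_small // addn0 modnMDl modn_small.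
Qed.

Lemma enum_places : map vplace (enum 'I_num_places) = [seq (q, t) | q <- iota 0 P, t <- types].
Proof. by rewrite -decode_iota -val_enum_ord -map_comp. Qed.

Lemma flatten_map_flatten (T U : Type) (f : T -> seq U) (ss : seq (seq T)) :
  flatten (map f (flatten ss)) = flatten [seq flatten (map f s) | s <- ss].
Proof. by elim: ss => //= s ss IH; rewrite map_cat flatten_cat IH. Qed.

Lemma flatten_places (U : Type) (f : place L -> seq U) :
  flatten [seq flatten [seq f (q, t) | t <- types] | q <- iota 0 P] =
  flatten [seq f (vplace v) | v <- enum 'I_num_places].
Proof.
rewrite (map_comp f vplace) enum_places flatten_map_flatten.
elim: (iota 0 P) => //= q s ->; congr (flatten _ ++ _).
by elim: (enum _) => //= t ts ->.
Qed.

Lemma map_places (U : Type) (f : place L -> U) :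
  flatten [seq flatten [seq [:: f (q, t)] | t <- types] | q <- iota 0 P] =
  [seq f (vplace v) | v <- enum 'I_num_places].
Proof. by rewrite (flatten_places (fun x => [:: f x])); elim: (enum _) => //= v s ->. Qed.
End Coding.

Section Instance.
Variables (k : nat) (N : acceptor) (x : seq bool).
Hypothesis k0 : 0 < k.
Local Notation C := (width k x).
Local Notation r := (height k x).
Local Notation L := (label N).
Local Notation info := (info_at x C r).
Local Notation P := (last_cell C r).+1.

Lemma height_ge : 1 < r.
Proof. by rewrite /height -{1}(expn0 (size x + 2)) ltn_exp2l // addn2. Qed.

Lemma width_gt : r.+1 < C.
Proof. have := height_ge; rewrite /width expnS -/(height k x); nia. Qed.

Lemma width_gt1 : 1 < C.
Proof. have := width_gt; lia. Qed.

Lemma info_borderP p o : p < P -> cell_border (info p) o = (p < offset C o).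
Proof. by move=> _; apply: info_border width_gt1. Qed.

Definition instance_vplace := @vplace L P.
Definition instance_host := host_graph (@label_allow N) cell_border (@label_rel N)
  info width_gt1 (ltn0Sn (last_cell C r)) instance_vplace.
Definition instance_terminals := host_terminals instance_vplace.

Definition reduction_instance : steiner_instance :=
  @SteinerInstance (num_places L P) instance_host instance_terminals erefl.

Lemma instance_encoding :
  encode_steiner_instance reduction_instance =
  encoding k x (@label_allow N) (@label_rel N).
Proof.
rewrite /encode_steiner_instance /encoding.
have := @map_places L P _ (fun=> true); cbv beta => ->.
have := @map_places L P _ (fun y => is_terminal y.2); cbv beta => ->.
congr (_ ++ _ :: _ ++ _).
- rewrite /= -[X in nseq X](size_enum_ord (num_places L P)).
  by elim: (enum _) => //= v s ->.
- have := @flatten_places L P _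
    (fun y => row_bits k x (@label_allow N) (@label_rel N) y.1 y.2); cbv beta => ->.
  rewrite /adj_bits; congr flatten; apply: eq_map => u; rewrite /row_bits.
  have := @map_places L P _ (fun y => link (@label_allow N) cell_border (@label_rel N) C info
    ((instance_vplace u).1, (instance_vplace u).2) y); cbv beta => ->.
  by apply: eq_map => v; rewrite host_adj; case: (instance_vplace u).
- by apply: eq_map => v; rewrite inE.
Qed.

Lemma instance_steiner :
  (forall cs, computation (init N x) cs -> size cs <= r) ->
  accepts N x <->
  exists T, minimal_internal_steiner_tree (host reduction_instance) (terminals reduction_instance) T.
Proof.
move=> bound; split.
  move=> /(accepts_tiling width_gt bound)[f ft].
  apply: minimal_internal_steiner_tree_exists.
  exact: (tiling_treeP width_gt1 (ltn0Sn _) info_borderP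
    (@vplaceK L P (ltn0Sn _)) (@mkplaceK L P (ltn0Sn _)) (@vplace_lt L P) ft).
move=> [T [hT _]]; have [f ft] := steiner_tiling info_borderP
  (@vplaceK L P (ltn0Sn _)) (@mkplaceK L P (ltn0Sn _)) (@vplace_lt L P) hT.
exact: (tiling_accepts (x := x) width_gt ft).
Qed.
End Instance.

(** The first halting or emitting time is either the first output or [T], hence at most the first
    delay. Outputs happen at times before [T] only, so an emitting state that is already halted
    outputs nothing. *)
Lemma first_event (M : enumerator) w T : halts_at M w T ->
  exists t, [/\ forall u, u < t -> ~~ halted (run M w u) && ~~ emitting (run M w u).1,
    halted (run M w t) || emitting (run M w t).1, t <= delay M w T 1 &
    emitting (run M w t).1 && ~~ halted (run M w t) = (0 < size (outputs M w T))].
Proof.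
move=> [hT nT]; pose ev t := halted (run M w t) || emitting (run M w t).1.
have exT : exists t, ev t by exists T; rewrite /ev hT.
case: (ex_minnP exT) => t evt tmin; exists t.
have tT : t <= T by apply: tmin; rewrite /ev hT.
have mem u : (u \in output_times M w T) = emitting (run M w u).1 && (u < T).
  by rewrite mem_filter mem_iota.
split=> //.
- move=> u ut; rewrite -negb_or; apply/negP => /tmin; lia.
- rewrite /delay /event_times /= subn0.
  case e: (output_times M w T) => [|u s] //=.
  by apply: tmin; have := mem u; rewrite e mem_head /ev => /esym/andP[-> _]; rewrite orbT.
rewrite size_map; apply/andP/idP => [[et nht]|].
  have lt : t < T by rewrite ltn_neqAle tT andbT; apply/eqP => e; rewrite e hT in nht.
  by have := mem t; rewrite et lt; case: (output_times _ _ _).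
case e: (output_times M w T) => [|u s] //= _.
have := mem u; rewrite e mem_head => /esym/andP[eu uT].
have tu : t <= u by apply: tmin; rewrite /ev eu orbT.
have nt := nT t (leq_ltn_trans tu uT).
by rewrite nt; move: evt; rewrite /ev (negbTE nt).
Qed.

(** * The polynomial-time decision procedure *)

Lemma pb_succ f : poly_bounded f -> poly_bounded (fun m => (f m).+1).
Proof.
move=> h; apply: (pb_le (g := fun m => f m + 1)) => [m|]; first by rewrite addn1.
exact: pb_add (pb_const 1).
Qed.

Ltac poly_bound :=
  repeat first [assumption | apply: pb_const | apply: pb_id | apply: pb_add
               | apply: pb_mul | apply: pb_exp | apply: pb_succ].

Lemma pb_nest_time l f : poly_bounded f -> poly_bounded (fun m => nest_time m l (f m)).
Proof.
move=> pf; elim: l => //= l IH; rewrite /loop_time.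
by poly_bound.
Qed.

(** [prepare_time] takes a word but depends on its length alone; [nseq m true] stands for all words
    of length [m]. *)
Lemma pb_prepare_time k : poly_bounded (fun m => prepare_time k (nseq m true)).
Proof.
pose t (f g : nat -> nat) m := (m * 2).+1 + (1 + (1 + (1 + ((m * 2).+1 + (1 + (4 + (1 +
   (f m + (1 + (g m + (1 + (f m + (f m + (1 + f m)))))))))))))).
have pt f g : poly_bounded f -> poly_bounded g -> poly_bounded (t f g).
  by move=> pf pg; rewrite /t; poly_bound.
have h1 := pb_nest_time k.+1 (pb_const 1).
apply: pb_le (pt _ _ h1 (pb_nest_time k (pb_add (pb_const 1) h1))) => m.
by rewrite /prepare_time size_nseq.
Qed.

Lemma prepare_time_size k x : prepare_time k x = prepare_time k (nseq (size x) true).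
Proof. by rewrite /prepare_time size_nseq. Qed.

Definition cells_bound k m := ((m + 2) ^ k).+1 * (m + 2) ^ k.+1.

Lemma pb_cells k : poly_bounded (cells_bound k).
Proof. by rewrite /cells_bound; poly_bound. Qed.

Definition encoding_bound k (L : finType) m :=
  let n := size (enum {: vtype L}) in
  let P := (cells_bound k m).+1 in
  let lt := (P * ((1 + n * 1) + 1).+1).+1 + (1 + ((P * 2).+1 + 1)) in
  lt + ((P * ((1 + n * lt) + 1).+1).+1 + (1 + lt)).

Lemma encoding_time_bound k x (L : finType) : encoding_time k x L = encoding_bound k L (size x).
Proof. by []. Qed.

Lemma pb_encoding_bound k L : poly_bounded (encoding_bound k L).
Proof. by have h := pb_cells k; rewrite /encoding_bound; cbv zeta; poly_bound. Qed.

(** A graph on [n] vertices takes [n] unary bits, a separator, [n * n] matrix bits and [n] terminal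
    bits. *)
Definition encoding_size k (L : finType) m :=
  let n := (cells_bound k m).+1 * size (enum {: vtype L}) in n + (n * n + n).+1.

Lemma pb_encoding_size k L : poly_bounded (encoding_size k L).
Proof. by have h := pb_cells k; rewrite /encoding_size; cbv zeta; poly_bound. Qed.

Lemma size_encoding k x N (k0 : 0 < k) :
  size (encode_steiner_instance (reduction_instance N x k0)) =
  encoding_size k (label N) (size x).
Proof.
rewrite /encode_steiner_instance size_cat size_nseq /= size_cat.
by rewrite /adj_bits size_allpairs /set_bits size_map !size_enum_ord.
Qed.

Theorem theorem6p1 :
  ~ P_eq_NP ->
  ~ exists M : enumerator,
      enumerates_in_incremental_poly_time M internal_steiner_tree_enumeration.
Proof.
(* P is contained in NP by forgetting determinism; the rest shows that the enumerator puts NP into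
   P. *)
move=> nP [M [p hM]]; apply: nP => L; split; first by case=> N _ hN; exists N.
case=> N [acc [q hq]].
have [k1 hk1] := pb_poly q.
(* [k1] already bounds the running time of [N]. The extra 1 makes the height exceed 1, so that the
   width exceeds the height plus 1. *)
pose k := k1.+1; have k0 : 0 < k by [].
pose c : cmd (alphabet M) (tname k (tapes M)) :=
  Seq (prepare M k) (Seq (write_encoding M k (@label_allow N) (@label_rel N)) (simulate M k)).
pose b (r : readings (alphabet M) (tname k (tapes M))) := sim_emitting r && ~~ sim_halted r.
(* The argument of [p] is the size of the encoded instance plus 1, the bound on the first delay. *)
pose F m := prepare_time k (nseq m true) + (encoding_bound k (label N) m +
  (1 + (p.[encoding_size k (label N) m + 1]%R * 2).+1)).
apply: (@program_in_P _ _ c b L F).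
  have h1 := pb_prepare_time k; have h2 := pb_encoding_bound k (label N).
  have h3 := pb_horner p (pb_add (pb_encoding_size k (label N)) (pb_const 1)).
  exact: pb_add h1 (pb_add h2 (pb_add (pb_const 1) (pb_succ (pb_mul h3 (pb_const 2))))).
move=> x; pose I := reduction_instance N x k0.
have bound cs : computation (init N x) cs -> size cs <= height k x.
  move=> /hq h; apply: leq_trans h _; apply: leq_trans (hk1 _) _.
  by rewrite /height leq_exp2l // addn2.
have [T [hT _ sol del]] := hM I.
have [t [t1 t2 t3 t4]] := first_event hT.
have [s e hs] := @exec_simulate M k x (encode_steiner_instance I) (-1)%R
  (Posz (last_cell (width k x) (height k x))) t t1 t2.
exists s.
  rewrite /F -prepare_time_size -encoding_time_bound.
  apply: execb_seq; first exact: exec_prepare.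
  rewrite prepared_writing; apply: execb_seq; first exact: exec_write_encoding.
  rewrite -instance_encoding; apply: execb_le e.
  rewrite leq_add2l ltnS leq_mul2r /=; apply: leq_trans t3 _.
  by rewrite -size_encoding; apply: del.
rewrite /b (sims_emitting hs) (sims_halted hs) t4 -acc (instance_steiner k0 bound).
split.
  case e': (outputs _ _ _) => [|w ws] // _.
  have /sol[T' hT' _] : w \in outputs M (encode_steiner_instance I) T by rewrite e' mem_head.
  by exists T'.
move=> [T' hT'].
have : encode_subgraph T' \in outputs M (encode_steiner_instance I) T.
  by apply/sol; exists T'.
by case: (outputs _ _ _).
Qed.
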